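(* Fix positive integers $r$, $k$, and $n$. Then there exist algorithmically computable compositions $\mathbf{s}_1,\ldots,\mathbf{s}_m$, coefficients $c_1,\ldots,c_m\in\mathbb{Q}$, and exponents $b_1,\ldots,b_m\in\mathbb{Z}$, all independent of $p$, such that \[ C_{r,k,p}\equiv\sum_{i=1}^m c_ip^{b_i}H_{p-1}(\mathbf{s}_i)\pmod{p^n} \] holds for all sufficiently large primes $p$.
   Context: A composition is a finite ordered list $\mathbf{s}=(s_1,\ldots,s_j)$ of positive integers, and $H_N(\mathbf{s})=\sum_{N\geq n_1>\cdots>n_j\geq1}\frac{1}{n_1^{s_1}\cdots n_j^{s_j}}$. For positive integers $r,k$ and a prime $p$, $C_{r,k,p}:=\sum\frac{1}{n_1\cdots n_k}$, the sum over $k$-tuples of positive integers with $n_1+\cdots+n_k=p^r$ and $p\nmid n_1\cdots n_k$. For rationals $x,y$, $x\equiv y\pmod{p^n}$ means the numerator of $x-y$ is divisible by $p^n$. *)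

(* Defs.v *)
From HB Require Import structures.
From mathcomp Require Import all_boot all_order all_algebra.

Set Implicit Arguments.
Unset Strict Implicit.
Unset Printing Implicit Defensive.

Import GRing.Theory Num.Theory.
Local Open Scope ring_scope.

Definition is_composition (s : seq nat) : bool := all (leq 1) s.

(* H_N(s); for the empty composition this is the empty product, 1. *)
Definition mhs (N : nat) (s : seq nat) : rat :=
  \sum_(n : {ffun 'I_(size s) -> 'I_N.+1}
         | [forall i, (0 < n i)%N]
           && [forall i : 'I_(size s), forall j : 'I_(size s),
                 (i < j)%N ==> (n j < n i)%N])
     \prod_(i < size s) ((n i)%:R ^+ nth 0%N s i)^-1.

(* C_{r,k,p}; bounding every n_i by p ^ r loses nothing, as the n_i sum to
   p ^ r. *)
Definition Csum (r k p : nat) : rat :=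
  \sum_(n : {ffun 'I_k -> 'I_(p ^ r).+1}
         | [&& [forall i, (0 < n i)%N],
               (\sum_(i < k) n i)%N == (p ^ r)%N
             & ~~ (p %| \prod_(i < k) n i)%N])
     (\prod_(i < k) (n i)%:R)^-1.

Definition rat_congr (M : nat) (x y : rat) : Prop := (M %| numq (x - y))%Z.

(* Kleene's general recursive functions: the least class of total functions
   nat^m -> nat containing zero, successor and the projections and closed under
   composition, primitive recursion and minimisation of regular functions. *)
Inductive recursive : forall m : nat, (m.-tuple nat -> nat) -> Prop :=
| rec_zero m : @recursive m (fun _ => 0%N)
| rec_succ : @recursive 1 (fun v => (thead v).+1)
| rec_proj m (i : 'I_m) : recursive (fun v => tnth v i)
| rec_comp m l (f : l.-tuple nat -> nat) (g : 'I_l -> m.-tuple nat -> nat) :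
    recursive f -> (forall i, recursive (g i)) ->
    recursive (fun v => f [tuple g i v | i < l])
| rec_primrec m (f : m.-tuple nat -> nat) (g : m.+2.-tuple nat -> nat)
    (h : m.+1.-tuple nat -> nat) :
    recursive f -> recursive g ->
    (forall v : m.-tuple nat, h (cons_tuple 0%N v) = f v) ->
    (forall (x : nat) (v : m.-tuple nat),
       h (cons_tuple x.+1 v)
       = g (cons_tuple x (cons_tuple (h (cons_tuple x v)) v))) ->
    recursive h
| rec_min m (f : m.+1.-tuple nat -> nat) (h : m.-tuple nat -> nat) :
    recursive f ->
    (forall v : m.-tuple nat, f (cons_tuple (h v) v) = 0%N) ->
    (forall (v : m.-tuple nat) (y : nat),
       (y < h v)%N -> f (cons_tuple y v) <> 0%N) ->
    recursive h
| rec_ext m (f h : m.-tuple nat -> nat) :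
    f =1 h -> recursive f -> recursive h.

(* Computability relative to the Goedel numberings given by [pickle], which on
   the types built from nat, int, rat, pairs and sequences are the explicit
   effective codings of the library. It is not meant for a countType whose
   [pickle] is abstract. *)
Definition computable (A B : countType) (f : A -> B) : Prop :=
  exists2 g : 1.-tuple nat -> nat,
    recursive g & forall a : A, g [tuple pickle a] = pickle (f a).

(* The term (s, c, b) stands for c * p ^ b * H_{p-1}(s). *)
Definition mhs_term : countType := (seq nat * rat * int)%type.

Definition term_comp (t : mhs_term) : seq nat := t.1.1.
Definition term_coef (t : mhs_term) : rat := t.1.2.
Definition term_expo (t : mhs_term) : int := t.2.

Definition eval_terms (p : nat) (L : seq mhs_term) : rat :=
  \sum_(t <- L) term_coef t * p%:R ^ term_expo t * mhs p.-1 (term_comp t).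

(* Main.v *)
Require Import Defs.
From HB Require Import structures.
From mathcomp Require Import all_boot all_order all_algebra.
From mathcomp Require Import zify ring.

(** Let P = p ^ (r - 1) and write x^(M) for the coefficient of y ^ M in
    (1 - y) ^ (- x), that is x (x + 1) ... (x + M - 1) / M!. The generating
    series of the numbers C_{r,k,p} t ^ k / k! over k is the coefficient of
    y ^ (p ^ r) in (1 - y ^ p) ^ (t / p) (1 - y) ^ (- t), the exponential of t
    times the sum of y ^ n / n over the n prime to p. Splitting off the
    multiples of p in t^(pN) gives t^(pN) = (t/p)^(N) W_N(t), where W_N(t) is
    the product of the 1 + t / n over n < pN prime to p; hence this coefficient
    is the sum over N <= P of (t/p)^(N) (- t/p)^(P - N) W_N(t).

    Truncating the p-adic expansion of each 1 / (a + p j) after E = n + k r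
    terms changes the coefficient of t ^ k by a multiple of p ^ n, and makes
    each coefficient of W_N a polynomial in N. After Newton interpolation in N
    the sum over N is evaluated by Vandermonde's identity, which leaves
    binomial coefficients binom(P - 1, c - 1), polynomial in P. Finally W_i is
    a product over 0 < a < p of polynomials in t, p and 1 / a, so expanding it
    yields the sums H_{p-1}(s) directly, without quasi-shuffle products. The
    resulting list of terms is built by loops over lists, hence computable. *)

Set Implicit Arguments.
Unset Strict Implicit.
Unset Printing Implicit Defensive.

(** * Recursive functions of one, two and three arguments *)

Definition recursive1 (f : nat -> nat) : Prop :=
  recursive (fun v : 1.-tuple nat => f (nth 0 v 0)).
Definition recursive2 (f : nat -> nat -> nat) : Prop :=
  recursive (fun v : 2.-tuple nat => f (nth 0 v 0) (nth 0 v 1)).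
Definition recursive3 (f : nat -> nat -> nat -> nat) : Prop :=
  recursive (fun v : 3.-tuple nat => f (nth 0 v 0) (nth 0 v 1) (nth 0 v 2)).

Lemma recursive_nth m i :
  i < m -> recursive (fun v : m.-tuple nat => nth 0 v i).
Proof.
move=> lt_im; apply: rec_ext (rec_proj (Ordinal lt_im)) => v.
by rewrite (tnth_nth 0).
Qed.

Lemma recursive_comp1 m (f : nat -> nat) (a : m.-tuple nat -> nat) :
  recursive1 f -> recursive a -> recursive (fun v => f (a v)).
Proof.
move=> rf ra.
apply: rec_ext (rec_comp (g := fun _ : 'I_1 => a) rf _) => // v.
by rewrite -(tnth_nth 0 _ (Ordinal (isT : 0 < 1))) tnth_mktuple.
Qed.

Lemma recursive_comp2 m (f : nat -> nat -> nat) (a b : m.-tuple nat -> nat) :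
  recursive2 f -> recursive a -> recursive b ->
  recursive (fun v => f (a v) (b v)).
Proof.
move=> rf ra rb.
pose g (i : 'I_2) := if val i == 0 then a else b.
apply: rec_ext (rec_comp (g := g) rf _) => [v|[[|[|]] ?] //].
by rewrite -!(tnth_nth 0 _ (Ordinal (isT : 0 < 2)))
           -!(tnth_nth 0 _ (Ordinal (isT : 1 < 2))) !tnth_mktuple.
Qed.

Lemma recursive_comp3 m (f : nat -> nat -> nat -> nat)
    (a b c : m.-tuple nat -> nat) :
  recursive3 f -> recursive a -> recursive b -> recursive c ->
  recursive (fun v => f (a v) (b v) (c v)).
Proof.
move=> rf ra rb rc.
pose g (i : 'I_3) := if val i == 0 then a else if val i == 1 then b else c.
apply: rec_ext (rec_comp (g := g) rf _) => [v|[[|[|[|]]] ?] //].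
by rewrite -!(tnth_nth 0 _ (Ordinal (isT : 0 < 3)))
           -!(tnth_nth 0 _ (Ordinal (isT : 1 < 3)))
           -!(tnth_nth 0 _ (Ordinal (isT : 2 < 3))) !tnth_mktuple.
Qed.

Lemma recursive_succ m (a : m.-tuple nat -> nat) :
  recursive a -> recursive (fun v => (a v).+1).
Proof.
apply: (recursive_comp1 (f := succn)).
by apply: rec_ext rec_succ => v; rewrite /thead (tnth_nth 0).
Qed.

Lemma recursive_cst m c : @recursive m (fun _ => c).
Proof. by elim: c => [|c IH]; [apply: rec_zero | apply: recursive_succ]. Qed.

Ltac recursive_args :=
  repeat (apply: recursive_succ || by apply: recursive_nth
          || by apply: recursive_cst).

Lemma recursive1_primrec (a : nat) (g : nat -> nat -> nat) (h : nat -> nat) :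
  recursive2 g -> h 0 = a -> (forall n, h n.+1 = g n (h n)) -> recursive1 h.
Proof.
move=> rg h0 hS.
by apply: (rec_primrec (m := 0) (recursive_cst 0 a) rg) => [v|n v] /=.
Qed.

Lemma recursive2_primrec (a : nat -> nat) (g : nat -> nat -> nat -> nat)
    (h : nat -> nat -> nat) :
  recursive1 a -> recursive3 g -> (forall y, h 0 y = a y) ->
  (forall n y, h n.+1 y = g n (h n y) y) -> recursive2 h.
Proof.
move=> ra rg h0 hS.
by apply: (rec_primrec (m := 1) ra rg) => [v|n v] /=; rewrite ?h0 ?hS.
Qed.

Lemma recursive3_primrec (a : nat -> nat -> nat) (g : nat -> nat -> nat -> nat)
    (h : nat -> nat -> nat -> nat) :
  recursive2 a -> recursive3 g -> (forall y z, h 0 y z = a y z) ->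
  (forall n y z, h n.+1 y z = g (h n y z) y z) -> recursive3 h.
Proof.
move=> ra rg h0 hS.
apply: (rec_primrec (m := 2)
          (g := fun v => g (nth 0 v 1) (nth 0 v 2) (nth 0 v 3)) ra) => [|v|n v].
- by apply: recursive_comp3 => //; recursive_args.
- by rewrite h0.
- by rewrite hS.
Qed.

Lemma recursive1_min (f : nat -> nat -> nat) (h : nat -> nat) :
  recursive2 f -> (forall y, f (h y) y = 0) ->
  (forall y x, x < h y -> f x y <> 0) -> recursive1 h.
Proof.
move=> rf fh0 h_min.
by apply: (rec_min (m := 1) rf) => [v|v x lt_xh] /=; [apply: fh0|apply: h_min].
Qed.

Lemma recursive2_min (f : nat -> nat -> nat -> nat) (h : nat -> nat -> nat) :
  recursive3 f -> (forall y z, f (h y z) y z = 0) ->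
  (forall y z x, x < h y z -> f x y z <> 0) -> recursive2 h.
Proof.
move=> rf fh0 h_min.
by apply: (rec_min (m := 2) rf) => [v|v x lt_xh] /=; [apply: fh0|apply: h_min].
Qed.

Lemma recursive2_add : recursive2 addn.
Proof.
by apply: (recursive2_primrec (a := id) (g := fun _ s _ => s.+1)) => //;
  recursive_args.
Qed.

Lemma recursive1_pred : recursive1 predn.
Proof.
by apply: (recursive1_primrec (g := fun n _ => n)) => //; recursive_args.
Qed.

Lemma recursive2_sub : recursive2 subn.
Proof.
suff rec_subr : recursive2 (fun x y => y - x).
  by apply: (recursive_comp2 rec_subr); recursive_args.
apply: (recursive2_primrec (a := id) (g := fun _ s _ => s.-1)) => [||y|n y].
- by recursive_args.
- by apply: (recursive_comp1 recursive1_pred); recursive_args.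
- by rewrite subn0.
- by rewrite subnS.
Qed.

Lemma recursive2_mul : recursive2 muln.
Proof.
apply: (recursive2_primrec (a := fun=> 0) (g := fun _ s z => z + s)) => //.
- by recursive_args.
- by apply: (recursive_comp2 recursive2_add); recursive_args.
Qed.

Lemma recursive1_exp2 : recursive1 (expn 2).
Proof.
apply: (recursive1_primrec (a := 1) (g := fun _ s => s + s)) => // [|n].
  by apply: (recursive_comp2 recursive2_add); recursive_args.
by rewrite expnS mul2n addnn.
Qed.

Lemma recursive2_div : recursive2 divn.
Proof.
apply: (recursive2_min (f := fun q x y => y * (x.+1 - q.+1 * y))).
- apply: (recursive_comp2 recursive2_mul); first by recursive_args.
  apply: (recursive_comp2 recursive2_sub); first by recursive_args.
  by apply: (recursive_comp2 recursive2_mul); recursive_args.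
- move=> x [//|y]; apply/eqP; rewrite muln_eq0 subn_eq0.
  by rewrite ltn_ceil // orbT.
- move=> x y q; case: y => [|y]; first by rewrite divn0.
  rewrite leq_divRL // => le_qx; apply/eqP.
  by rewrite muln_eq0 subn_eq0 -ltnNge ltnS.
Qed.

Lemma modn_subE m d : m %% d = m - m %/ d * d.
Proof. by rewrite {2}(divn_eq m d) addKn. Qed.

Lemma recursive2_mod : recursive2 modn.
Proof.
apply: (rec_ext (f := fun v : 2.-tuple nat =>
  nth 0 v 0 - nth 0 v 0 %/ nth 0 v 1 * nth 0 v 1)) => [v|].
  by rewrite modn_subE.
apply: (recursive_comp2 recursive2_sub); first by recursive_args.
apply: (recursive_comp2 recursive2_mul); last by recursive_args.
by apply: (recursive_comp2 recursive2_div); recursive_args.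
Qed.

Lemma recursive1_logn2 : recursive1 (logn 2).
Proof.
apply: (recursive1_min (f := fun x z => z * (1 - z %% 2 ^ x.+1))).
- apply: (recursive_comp2 recursive2_mul); first by recursive_args.
  apply: (recursive_comp2 recursive2_sub); first by recursive_args.
  apply: (recursive_comp2 recursive2_mod); first by recursive_args.
  by apply: (recursive_comp1 recursive1_exp2); recursive_args.
- move=> [|z] //.
  suff : ~~ (2 ^ (logn 2 z.+1).+1 %| z.+1) by rewrite /dvdn; lia.
  by rewrite pfactor_dvdn // ltnn.
- move=> [|z] x; first by rewrite logn0.
  by rewrite -(pfactor_dvdn _ (isT : prime 2)) // /dvdn => /eqP ->.
Qed.

Definition nat_if (b x y : nat) : nat := if b is _.+1 then x else y.

Lemma recursive3_if : recursive3 nat_if.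
Proof.
by apply: (recursive3_primrec (a := fun _ y => y) (g := fun _ x _ => x)) => //;
  recursive_args.
Qed.

(** * The coding of pairs and lists *)

(* One step of [CodeSeq.code]. *)
Definition code_cons (x s : nat) : nat := 2 ^ x * s.*2.+1.
Definition code_head (z : nat) : nat := logn 2 z.
Definition code_tail (z : nat) : nat := z %/ 2 ^ (code_head z).+1.

Definition code_pair (x y : nat) : nat := code_cons x (code_cons y 0).
Definition code_fst (z : nat) : nat := code_head z.
Definition code_snd (z : nat) : nat := code_head (code_tail z).

Lemma code_cons_gt0 x s : 0 < code_cons x s.
Proof. by rewrite muln_gt0 expn_gt0. Qed.

Lemma code_consK1 x s : code_head (code_cons x s) = x.
Proof.
rewrite /code_head /code_cons lognM ?expn_gt0 // pfactorK // lognE dvdn2 /=.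
by rewrite odd_double addn0.
Qed.

Lemma code_consK2 x s : code_tail (code_cons x s) = s.
Proof.
rewrite /code_tail code_consK1 /code_cons expnSr divnMl ?expn_gt0 //.
by rewrite -muln2 -addn1 divnMDl // addn0.
Qed.

Lemma code_pairK1 x y : code_fst (code_pair x y) = x.
Proof. exact: code_consK1. Qed.

Lemma code_pairK2 x y : code_snd (code_pair x y) = y.
Proof. by rewrite /code_snd /code_pair code_consK2 code_consK1. Qed.

Lemma recursive1_head : recursive1 code_head.
Proof. exact: recursive1_logn2. Qed.

Lemma recursive1_tail : recursive1 code_tail.
Proof.
apply: (recursive_comp2 recursive2_div); first by recursive_args.
apply/(recursive_comp1 recursive1_exp2)/recursive_succ.
exact: recursive1_head.
Qed.

Lemma recursive1_snd : recursive1 code_snd.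
Proof. exact: (recursive_comp1 recursive1_head recursive1_tail). Qed.

Lemma recursive2_cons : recursive2 code_cons.
Proof.
apply: (recursive_comp2 recursive2_mul).
  by apply: (recursive_comp1 recursive1_exp2); recursive_args.
apply: recursive_succ.
apply: (rec_ext (f := fun v : 2.-tuple nat => nth 0 v 1 + nth 0 v 1)).
  by move=> v; rewrite addnn.
by apply: (recursive_comp2 recursive2_add); recursive_args.
Qed.

Lemma recursive2_pair : recursive2 code_pair.
Proof.
apply: (recursive_comp2 recursive2_cons); first by recursive_args.
by apply: (recursive_comp2 recursive2_cons); recursive_args.
Qed.

Lemma pickle_nat (n : nat) : pickle n = n.
Proof. by []. Qed.

Lemma pickle_bool (b : bool) : pickle b = b.
Proof. by []. Qed.

Lemma pickle_pair (A B : countType) (a : A) (b : B) :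
  pickle (a, b) = code_pair (pickle a) (pickle b).
Proof. by []. Qed.

Lemma pickle_cons (A : countType) (a : A) (s : seq A) :
  pickle (a :: s) = code_cons (pickle a) (pickle s).
Proof. by []. Qed.

Lemma pickle_Posz (n : nat) : pickle (Posz n) = code_pair (code_cons n 0) 0.
Proof. by []. Qed.

Lemma pickle_Negz (n : nat) : pickle (Negz n) = code_pair 0 (code_cons n 0).
Proof. by []. Qed.

Lemma pickle_rat (q : rat) : pickle q = pickle (valq q).
Proof. by []. Qed.

Lemma leq_size_pickle (A : countType) (s : seq A) : size s <= pickle s.
Proof.
elim: s => // b t IH; rewrite pickle_cons /code_cons /=.
have : 0 < 2 ^ pickle b by rewrite expn_gt0.
by move: IH; nia.
Qed.

(** * Computable functions between countable types *)

Lemma computableP (A B : countType) (f : A -> B) :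
  computable f <->
    exists2 g, recursive1 g & forall a, g (pickle a) = pickle (f a).
Proof.
split=> [[g rg gE]|[g rg gE]];
  last by exists (fun v : 1.-tuple nat => g (nth 0 v 0)).
exists (fun x => g [tuple x]) => //; apply: rec_ext rg => v.
by congr g; apply: val_inj; case: v => -[|? []].
Qed.

Lemma computable_ext (X A : countType) (f g : X -> A) :
  f =1 g -> computable f -> computable g.
Proof. by move=> fg [h rh hE]; exists h => // x; rewrite hE fg. Qed.

Lemma computable_comp (A B C : countType) (f : B -> C) (a : A -> B) :
  computable f -> computable a -> computable (fun x => f (a x)).
Proof.
move=> /computableP[g rg gE] /computableP[h rh hE]; apply/computableP.
exists (fun x => g (h x)) => [|x]; last by rewrite hE gE.
exact: (recursive_comp1 rg).
Qed.

Lemma computable_id (A : countType) : computable (fun x : A => x).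
Proof. by apply/computableP; exists id => //; recursive_args. Qed.

Lemma computable_cst (X A : countType) (a : A) : computable (fun _ : X => a).
Proof.
by apply/computableP; exists (fun _ => pickle a) => //; recursive_args.
Qed.

Lemma computable_pair (X A B : countType) (a : X -> A) (b : X -> B) :
  computable a -> computable b -> computable (fun x => (a x, b x)).
Proof.
move=> /computableP[g rg gE] /computableP[h rh hE]; apply/computableP.
exists (fun x => code_pair (g x) (h x)) => [|x]; last by rewrite hE gE.
exact: (recursive_comp2 recursive2_pair).
Qed.

Lemma computable_fst (X A B : countType) (a : X -> A * B) :
  computable a -> computable (fun x => (a x).1).
Proof.
apply: computable_comp; apply/computableP; exists code_fst => [|[x y]].
  exact: recursive1_head.
by rewrite pickle_pair code_pairK1.
Qed.

Lemma computable_snd (X A B : countType) (a : X -> A * B) :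
  computable a -> computable (fun x => (a x).2).
Proof.
apply: computable_comp; apply/computableP; exists code_snd => [|[x y]].
  exact: recursive1_snd.
by rewrite pickle_pair code_pairK2.
Qed.

Lemma computable_comp2 (X A B C : countType) (f : A -> B -> C)
    (a : X -> A) (b : X -> B) :
  computable (fun y : A * B => f y.1 y.2) -> computable a -> computable b ->
  computable (fun x => f (a x) (b x)).
Proof.
move=> cf ca cb.
exact: (computable_comp (a := fun x => (a x, b x)) cf (computable_pair ca cb)).
Qed.

Create HintDb computable discriminated.
#[local] Hint Resolve computable_id computable_cst computable_pair
  computable_fst computable_snd : computable.
#[local] Hint Extern 8 (computable (fun _ => ?f _)) =>
  match goal with
  | cf : computable f |- _ => apply: (computable_comp cf)
  end : computable.
#[local] Hint Extern 8 (computable (fun _ => ?f _ _)) =>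
  match goal with
  | cf : computable (fun y => f y.1 y.2) |- _ => apply: (computable_comp2 cf)
  end : computable.

Ltac computability := by auto 40 with computable nocore.

Lemma computable_recursive1 (X : countType) (f : nat -> nat) (a : X -> nat) :
  recursive1 f -> computable a -> computable (fun x => f (a x)).
Proof. by move=> rf; apply: computable_comp; apply/computableP; exists f. Qed.

Lemma computable_recursive2 (X : countType) (f : nat -> nat -> nat)
    (a b : X -> nat) :
  recursive2 f -> computable a -> computable b ->
  computable (fun x => f (a x) (b x)).
Proof.
move=> rf; apply: computable_comp2; apply/computableP.
exists (fun z => f (code_fst z) (code_snd z)) => [|[x y]].
  exact: (recursive_comp2 rf recursive1_head recursive1_snd).
by rewrite pickle_pair code_pairK1 code_pairK2.
Qed.

Lemma computable_succ (X : countType) (a : X -> nat) :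
  computable a -> computable (fun x => (a x).+1).
Proof. by apply: computable_recursive1; recursive_args. Qed.

Lemma computable_pred (X : countType) (a : X -> nat) :
  computable a -> computable (fun x => (a x).-1).
Proof. exact: (computable_recursive1 recursive1_pred). Qed.

Lemma computable_addn (X : countType) (a b : X -> nat) :
  computable a -> computable b -> computable (fun x => a x + b x).
Proof. exact: (computable_recursive2 recursive2_add). Qed.

Lemma computable_subn (X : countType) (a b : X -> nat) :
  computable a -> computable b -> computable (fun x => a x - b x).
Proof. exact: (computable_recursive2 recursive2_sub). Qed.

Lemma computable_muln (X : countType) (a b : X -> nat) :
  computable a -> computable b -> computable (fun x => a x * b x).
Proof. exact: (computable_recursive2 recursive2_mul). Qed.

Lemma computable_divn (X : countType) (a b : X -> nat) :
  computable a -> computable b -> computable (fun x => a x %/ b x).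
Proof. exact: (computable_recursive2 recursive2_div). Qed.

Lemma computable_modn (X : countType) (a b : X -> nat) :
  computable a -> computable b -> computable (fun x => a x %% b x).
Proof. exact: (computable_recursive2 recursive2_mod). Qed.

#[local] Hint Resolve computable_succ computable_pred computable_addn
  computable_subn computable_muln computable_divn computable_modn : computable.

Lemma computable_if (X A : countType) (b : X -> bool) (f g : X -> A) :
  computable b -> computable f -> computable g ->
  computable (fun x => if b x then f x else g x).
Proof.
move=> /computableP[b' rb bE] /computableP[f' rf fE] /computableP[g' rg gE].
apply/computableP; exists (fun x => nat_if (b' x) (f' x) (g' x)) => [|x].
  exact: (recursive_comp3 recursive3_if).
by rewrite bE fE gE pickle_bool; case: (b x).
Qed.

Lemma computable_nat_of_bool (X : countType) (b : X -> bool) :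
  computable (fun x => nat_of_bool (b x)) -> computable b.
Proof. by move=> /computableP[g rg gE]; apply/computableP; exists g. Qed.

Lemma computable_leq (X : countType) (a b : X -> nat) :
  computable a -> computable b -> computable (fun x => a x <= b x).
Proof.
move=> ca cb; apply: computable_nat_of_bool.
apply: (computable_ext (f := fun x => 1 - (a x - b x))); last by computability.
by move=> x; rewrite /leq; case: (a x - b x).
Qed.

#[local] Hint Resolve computable_if computable_leq : computable.

Lemma computable_eqn (X : countType) (a b : X -> nat) :
  computable a -> computable b -> computable (fun x => a x == b x).
Proof.
move=> ca cb; apply: (computable_ext
  (f := fun x => if a x <= b x then b x <= a x else false)) => [x|].
  by rewrite eqn_leq; case: leq.
by computability.
Qed.

#[local] Hint Resolve computable_eqn : computable.

Lemma computable_iter (X A : countType) (n : X -> nat) (g : X -> A -> A)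
    (a : X -> A) :
  computable n -> computable (fun y : X * A => g y.1 y.2) -> computable a ->
  computable (fun x => iter (n x) (g x) (a x)).
Proof.
move=> /computableP[n' rn nE] /computableP[g' rg gE] /computableP[a' ra aE].
have riter : recursive3 (fun k x => iter k (fun y => g' (code_pair x y))).
  apply: (recursive3_primrec (a := fun _ y => y)
            (g := fun y x _ => g' (code_pair x y))) => //.
    by recursive_args.
  by apply: (recursive_comp1 rg); apply: (recursive_comp2 recursive2_pair);
    recursive_args.
apply/computableP.
exists (fun x => iter (n' x) (fun y => g' (code_pair x y)) (a' x)) => [|x].
  by apply: (recursive_comp3 riter) => //; recursive_args.
rewrite nE aE pickle_nat; elim: (n x) => //= k ->.
by rewrite -pickle_pair gE.
Qed.

Lemma computable_cons (X A : countType) (a : X -> A) (s : X -> seq A) :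
  computable a -> computable s -> computable (fun x => a x :: s x).
Proof.
move=> /computableP[g rg gE] /computableP[h rh hE]; apply/computableP.
exists (fun x => code_cons (g x) (h x)) => [|x]; last by rewrite hE gE.
exact: (recursive_comp2 recursive2_cons).
Qed.

#[local] Hint Resolve computable_iter computable_cons : computable.

Lemma computable_case_seq (X A B : countType) (s : X -> seq A) (f : X -> B)
    (g : X -> A -> seq A -> B) :
  computable s -> computable f ->
  computable (fun y : X * A * seq A => g y.1.1 y.1.2 y.2) ->
  computable (fun x => if s x is b :: t then g x b t else f x).
Proof.
move=> /computableP[s' rs sE] /computableP[f' rf fE] /computableP[g' rg gE].
pose cons_case z x :=
  g' (code_pair (code_pair x (code_head z)) (code_tail z)).
apply/computableP; exists (fun x => nat_if (s' x) (cons_case (s' x) x) (f' x)).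
  apply: (recursive_comp3 recursive3_if) => //; apply: (recursive_comp1 rg).
  apply: (recursive_comp2 recursive2_pair).
    apply: (recursive_comp2 recursive2_pair); first by recursive_args.
    exact: (recursive_comp1 recursive1_head).
  exact: (recursive_comp1 recursive1_tail).
move=> x; rewrite sE fE; case: (s x) => [//|b t].
rewrite pickle_cons /cons_case code_consK1 code_consK2 -!pickle_pair gE.
by case: code_cons (code_cons_gt0 (pickle b) (pickle t)).
Qed.

Lemma computable_foldl (X A B : countType) (s : X -> seq B) (a : X -> A)
    (g : X -> A -> B -> A) :
  computable s -> computable (fun y : X * A * B => g y.1.1 y.1.2 y.2) ->
  computable a -> computable (fun x => foldl (g x) (a x) (s x)).
Proof.
move=> cs cg ca.
pose step x (y : A * seq B) := if y.2 is b :: t then (g x y.1 b, t) else y.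
have cstep : computable (fun y : X * (A * seq B) => step y.1 y.2).
  apply: (computable_case_seq (s := fun y : X * (A * seq B) => y.2.2)
            (g := fun y b t => (g y.1 y.2.1 b, t))); try computability.
  apply: computable_pair; last by computability.
  apply: (computable_comp (a := fun y : X * (A * seq B) * B * seq B =>
            (y.1.1.1, y.1.1.2.1, y.1.2)) cg).
  by computability.
have cpickle : computable (fun x => pickle (s x)).
  by case: cs => s' rs sE; exists s' => // x; rewrite sE.
apply: computable_ext (computable_fst
  (computable_iter cpickle cstep (computable_pair ca cs))) => x.
suff iter_step n z t :
    size t <= n -> (iter n (step x) (z, t)).1 = foldl (g x) z t.
  exact/iter_step/leq_size_pickle.
elim: n z t => [|n IHn] z t; first by case: t.
rewrite iterSr /step; case: t => [|b t] le_tn; last exact: IHn.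
exact: (IHn _ [::]).
Qed.

Lemma computable_rev (X A : countType) (s : X -> seq A) :
  computable s -> computable (fun x => rev (s x)).
Proof.
move=> cs; apply: (computable_ext
  (f := fun x => foldl (fun t b => b :: t) [::] (s x))) => [x|].
  by rewrite /rev; elim: (s x) [::] => //= b t IH u; rewrite IH.
by apply: (computable_foldl (g := fun=> fun t b => b :: t)); computability.
Qed.

Lemma computable_foldr (X A B : countType) (s : X -> seq B) (a : X -> A)
    (g : X -> B -> A -> A) :
  computable s -> computable (fun y : X * B * A => g y.1.1 y.1.2 y.2) ->
  computable a -> computable (fun x => foldr (g x) (a x) (s x)).
Proof.
move=> cs cg ca; apply: (computable_ext
  (f := fun x => foldl (fun z b => g x b z) (a x) (rev (s x)))) => [x|].
  by rewrite foldl_rev.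
apply: (computable_foldl (g := fun x z b => g x b z)) => //.
  exact: computable_rev.
apply: (computable_comp (a := fun y : X * A * B => (y.1.1, y.2, y.1.2)) cg).
by computability.
Qed.

Lemma computable_map (X A B : countType) (s : X -> seq A) (g : X -> A -> B) :
  computable s -> computable (fun y : X * A => g y.1 y.2) ->
  computable (fun x => [seq g x b | b <- s x]).
Proof.
move=> cs cg.
apply: (computable_foldr (g := fun x b t => g x b :: t)); try computability.
Qed.

Lemma computable_filter (X A : countType) (s : X -> seq A)
    (g : X -> A -> bool) :
  computable s -> computable (fun y : X * A => g y.1 y.2) ->
  computable (fun x => [seq b <- s x | g x b]).
Proof.
move=> cs cg.
by apply: (computable_foldr (g := fun x b t => if g x b then b :: t else t));
  computability.
Qed.

Lemma computable_cat (X A : countType) (s t : X -> seq A) :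
  computable s -> computable t -> computable (fun x => s x ++ t x).
Proof.
move=> cs ct; apply: (computable_ext
  (f := fun x => foldr cons (t x) (s x))) => [x|].
  by elim: (s x) => //= b u ->.
by apply: (computable_foldr (g := fun=> cons)); computability.
Qed.

#[local] Hint Resolve computable_map computable_filter computable_cat
  : computable.

Lemma computable_flatten (X A : countType) (s : X -> seq (seq A)) :
  computable s -> computable (fun x => flatten (s x)).
Proof.
by move=> cs; apply: (computable_foldr (g := fun=> cat)); computability.
Qed.

Lemma computable_iota0 (X : countType) (a : X -> nat) :
  computable a -> computable (fun x => iota 0 (a x)).
Proof.
move=> ca; pose step (y : nat * seq nat) := (y.1.-1, y.1.-1 :: y.2).
apply: (computable_ext
  (f := fun x => (iter (a x) step (a x, [::])).2)) => [x|].
  suff iter_step i : i <= a x ->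
      iter i step (a x, [::]) = (a x - i, iota (a x - i) i).
    by rewrite iter_step // subnn.
  elim: i => [|i IH] lt_ia; rewrite /= ?subn0 // IH 1?ltnW // /step /=.
  by rewrite -subnS; congr (_, _ :: iota _ _); rewrite subnSK.
by apply: computable_snd; apply: (computable_iter (g := fun=> step));
  rewrite /step; computability.
Qed.

#[local] Hint Resolve computable_flatten computable_iota0 : computable.

Lemma computable_fact (X : countType) (a : X -> nat) :
  computable a -> computable (fun x => (a x)`!).
Proof.
move=> ca; apply: (computable_ext
  (f := fun x => foldr (fun i m => i.+1 * m) 1 (iota 0 (a x)))) => [x|].
  by rewrite fact_prod -(foldr_map (fun i => i.+1) muln) -(iotaDl 1)
    unlock /reducebig /index_iota subSS subn0.
by apply: (computable_foldr (g := fun=> fun i m => i.+1 * m)); computability.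
Qed.

#[local] Hint Resolve computable_fact : computable.

Lemma computable_bin (X : countType) (a b : X -> nat) :
  computable a -> computable b -> computable (fun x => 'C(a x, b x)).
Proof.
move=> ca cb; apply: (computable_ext (f := fun x =>
  if b x <= a x then (a x)`! %/ ((b x)`! * (a x - b x)`!) else 0)).
  move=> x; case: leqP => [le_ba|lt_ab]; last by rewrite bin_small.
  by rewrite -(bin_fact le_ba) mulnK // muln_gt0 !fact_gt0.
by computability.
Qed.

Definition euclid_step (y : nat * nat) : nat * nat :=
  if y.1 == 0 then y else (y.2 %% y.1, y.1).

Lemma iter_euclid_step n a b :
  a <= n -> (iter n euclid_step (a, b)).2 = gcdn a b.
Proof.
elim: n a b => [|n IH] a b; first by rewrite leqn0 => /eqP ->; rewrite gcd0n.
rewrite iterSr {2}/euclid_step /= => le_an.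
have [->|a_neq0] := eqVneq a 0; first by rewrite IH.
rewrite IH ?gcdn_modl; first exact: gcdnC.
by rewrite -ltnS (leq_trans _ le_an) // ltn_mod lt0n.
Qed.

Lemma computable_gcdn (X : countType) (a b : X -> nat) :
  computable a -> computable b -> computable (fun x => gcdn (a x) (b x)).
Proof.
move=> ca cb.
apply: (computable_ext (f := fun x => (iter (a x) euclid_step (a x, b x)).2)).
  by move=> x; rewrite iter_euclid_step.
by apply: computable_snd; apply: (computable_iter (g := fun=> euclid_step));
  rewrite /euclid_step; computability.
Qed.

#[local] Hint Resolve computable_bin computable_gcdn : computable.

Import Order.TTheory GRing.Theory Num.Theory.
Local Open Scope ring_scope.

Lemma computable_Posz (X : countType) (a : X -> nat) :
  computable a -> computable (fun x => Posz (a x)).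
Proof.
move=> /computableP[g rg gE]; apply/computableP.
exists (fun x => code_pair (code_cons (g x) 0) 0) => [|x].
  apply: (recursive_comp2 recursive2_pair); last by recursive_args.
  by apply: (recursive_comp2 recursive2_cons); recursive_args.
by rewrite gE pickle_Posz.
Qed.

Lemma computable_Negz (X : countType) (a : X -> nat) :
  computable a -> computable (fun x => Negz (a x)).
Proof.
move=> /computableP[g rg gE]; apply/computableP.
exists (fun x => code_pair 0 (code_cons (g x) 0)) => [|x].
  apply: (recursive_comp2 recursive2_pair); first by recursive_args.
  by apply: (recursive_comp2 recursive2_cons); recursive_args.
by rewrite gE pickle_Negz.
Qed.

Lemma computable_case_int (X A : countType) (z : X -> int)
    (f g : X -> nat -> A) :
  computable z -> computable (fun y : X * nat => f y.1 y.2) ->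
  computable (fun y : X * nat => g y.1 y.2) ->
  computable (fun x =>
    match z x with Posz n => f x n | Negz n => g x n end).
Proof.
move=> /computableP[z' rz zE] /computableP[f' rf fE] /computableP[g' rg gE].
apply/computableP; exists (fun x => nat_if (code_fst (z' x))
  (f' (code_pair x (code_head (code_fst (z' x)))))
  (g' (code_pair x (code_head (code_snd (z' x)))))) => [|x].
  have rec_arg : recursive (fun v : 1.-tuple nat => nth 0%N v 0).
    by recursive_args.
  have rec_head := recursive_comp1 recursive1_head.
  apply: (recursive_comp3 recursive3_if); first exact: rec_head.
    apply: (recursive_comp1 rf); apply: (recursive_comp2 recursive2_pair) => //.
    exact/rec_head/rec_head.
  apply: (recursive_comp1 rg); apply: (recursive_comp2 recursive2_pair) => //.
  exact/rec_head/(recursive_comp1 recursive1_snd).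
rewrite zE; case: (z x) => n.
  rewrite pickle_Posz code_pairK1 code_consK1 -[n in LHS]pickle_nat.
  by rewrite -pickle_pair fE; case: code_cons (code_cons_gt0 (pickle n) 0).
rewrite pickle_Negz code_pairK1 code_pairK2 code_consK1 -[n in LHS]pickle_nat.
by rewrite -pickle_pair gE.
Qed.

#[local] Hint Resolve computable_Posz computable_Negz : computable.

Definition pos_part (z : int) : nat := if z is Posz n then n else 0%N.
Definition neg_part (z : int) : nat := if z is Negz n then n.+1 else 0%N.

Lemma pos_neg_partE z : z = (pos_part z)%:Z - (neg_part z)%:Z.
Proof. by case: z => n /=; lia. Qed.

Lemma computable_pos_part (X : countType) (z : X -> int) :
  computable z -> computable (fun x => pos_part (z x)).
Proof.
by move=> cz; apply: (computable_case_int
  (f := fun=> id) (g := fun _ _ => 0%N)); computability.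
Qed.

Lemma computable_neg_part (X : countType) (z : X -> int) :
  computable z -> computable (fun x => neg_part (z x)).
Proof.
by move=> cz; apply: (computable_case_int
  (f := fun _ _ => 0%N) (g := fun=> succn)); computability.
Qed.

#[local] Hint Resolve computable_pos_part computable_neg_part : computable.

Lemma computable_subz_nat (X : countType) (a b : X -> nat) :
  computable a -> computable b -> computable (fun x => (a x)%:Z - (b x)%:Z).
Proof.
move=> ca cb; apply: (computable_ext (f := fun x =>
  if (b x <= a x)%N then Posz (a x - b x) else Negz (b x - a x).-1)) => [x|].
  by case: leqP => le_ab; lia.
by computability.
Qed.

#[local] Hint Resolve computable_subz_nat : computable.

Lemma computable_addz (X : countType) (a b : X -> int) :
  computable a -> computable b -> computable (fun x => a x + b x).
Proof.
move=> ca cb; apply: (computable_ext (f := fun x =>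
  (pos_part (a x) + pos_part (b x))%N%:Z
  - (neg_part (a x) + neg_part (b x))%N%:Z)) => [x|]; last by computability.
by rewrite [in RHS](pos_neg_partE (a x)) [in RHS](pos_neg_partE (b x)); lia.
Qed.

Lemma computable_mulz (X : countType) (a b : X -> int) :
  computable a -> computable b -> computable (fun x => a x * b x).
Proof.
move=> ca cb; apply: (computable_ext (f := fun x =>
  (pos_part (a x) * pos_part (b x) + neg_part (a x) * neg_part (b x))%N%:Z
  - (pos_part (a x) * neg_part (b x) + neg_part (a x) * pos_part (b x))%N%:Z)).
  move=> x; rewrite [in RHS](pos_neg_partE (a x)) [in RHS](pos_neg_partE (b x)).
  by rewrite !PoszD !PoszM; ring.
by computability.
Qed.

Lemma computable_absz (X : countType) (a : X -> int) :
  computable a -> computable (fun x => `|a x|%N).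
Proof.
move=> ca; apply: (computable_ext
  (f := fun x => pos_part (a x) + neg_part (a x))%N) => [x|].
  by case: (a x) => n /=; rewrite ?addn0.
by computability.
Qed.

Lemma computable_sgz (X : countType) (a : X -> int) :
  computable a -> computable (fun x => sgz (a x)).
Proof.
move=> ca; apply: (computable_ext (f := fun x =>
  if (0 < pos_part (a x))%N then 1
  else if (0 < neg_part (a x))%N then -1 else 0)).
  by move=> x; case: (a x) => [[|n]|n].
by computability.
Qed.

#[local] Hint Resolve computable_addz computable_mulz computable_absz
  computable_sgz : computable.

Lemma computable_numq (X : countType) (q : X -> rat) :
  computable q -> computable (fun x => numq (q x)).
Proof. by move=> cq; apply: (computable_fst (a := fun x => valq (q x))). Qed.

Lemma computable_denq (X : countType) (q : X -> rat) :
  computable q -> computable (fun x => denq (q x)).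
Proof. by move=> cq; apply: (computable_snd (a := fun x => valq (q x))). Qed.

Lemma fracq_subdefE (n d : int) : fracq_subdef (n, d) =
  if `|d|%N == 0%N then (0, 1) else
  (sgz n * sgz d * (`|n| %/ gcdn `|n| `|d|)%N%:Z,
   (`|d| %/ gcdn `|n| `|d|)%N%:Z).
Proof.
rewrite /fracq_subdef /= absz_eq0; case: eqP => //= /eqP d_neq0.
congr (_, _); have [->|n_neq0] := eqVneq n 0.
  by rewrite div0n mulr0 mul0r.
by rewrite -exprnP signr_addb !sgz_def n_neq0 d_neq0 !mulr1n [X in X * _]mulrC.
Qed.

Lemma computable_frac (X : countType) (a b : X -> int) :
  computable a -> computable b ->
  computable (fun x => (a x)%:~R / (b x)%:~R : rat).
Proof.
move=> ca cb; have : computable (fun x => fracq_subdef (a x, b x)).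
  apply: (computable_ext (fun x => esym (fracq_subdefE (a x) (b x)))).
  by computability.
case=> g rg gE; exists g => // x.
by rewrite gE -[_ / _](fracqE (a x, b x)) pickle_rat -val_fracq.
Qed.

#[local] Hint Resolve computable_numq computable_denq computable_frac
  : computable.

Lemma computable_mulq (X : countType) (a b : X -> rat) :
  computable a -> computable b -> computable (fun x => a x * b x).
Proof.
move=> ca cb; apply: (computable_ext (f := fun x =>
  (numq (a x) * numq (b x))%:~R / (denq (a x) * denq (b x))%:~R)) => [x|].
  by rewrite !intrM -mulf_div !divq_num_den.
by computability.
Qed.

Lemma computable_invq (X : countType) (a : X -> rat) :
  computable a -> computable (fun x => (a x)^-1).
Proof.
move=> ca; apply: (computable_ext
  (f := fun x => (denq (a x))%:~R / (numq (a x))%:~R)) => [x|].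
  by rewrite -{3}[a x]divq_num_den invf_div.
by computability.
Qed.

Lemma computable_natq (X : countType) (a : X -> nat) :
  computable a -> computable (fun x => (a x)%:R : rat).
Proof.
move=> ca; apply: (computable_ext (f := fun x => (Posz (a x))%:~R / 1%:~R)).
  by move=> x; rewrite divr1.
by computability.
Qed.

#[local] Hint Resolve computable_mulq computable_invq computable_natq
  : computable.

Lemma computable_expq (X : countType) (a : X -> rat) (n : X -> nat) :
  computable a -> computable n -> computable (fun x => a x ^+ n x).
Proof.
move=> ca cn; apply: (computable_ext
  (f := fun x => iter (n x) (fun q => a x * q) 1)) => [x|].
  by elim: (n x) => //= m ->; rewrite exprS.
by apply: (computable_iter (g := fun x q => a x * q)); computability.
Qed.

#[local] Hint Resolve computable_expq : computable.

(** * Power series as sequences *)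

Section CauchyProduct.
Variable R : comNzRingType.
Implicit Types f g h : nat -> R.

Definition cauchy_mul f g (M : nat) : R := \sum_(i < M.+1) f i * g (M - i)%N.

Definition dilate (p : nat) f (M : nat) : R :=
  if (p %| M)%N then f (M %/ p)%N else 0.

(* The operator y d/dy. *)
Definition euler f (M : nat) : R := f M *+ M.

Lemma coef_mul_truncated D M f g : (M <= D)%N ->
  (\poly_(i < D.+1) f i * \poly_(i < D.+1) g i)`_M = cauchy_mul f g M.
Proof.
move=> le_MD; rewrite coefM; apply: eq_bigr => -[i lt_iM] _ /=.
by rewrite !coef_poly !ltnS !(leq_trans _ le_MD) ?leq_subr.
Qed.

Lemma eq_cauchy_mul f f' g g' :
  f =1 f' -> g =1 g' -> cauchy_mul f g =1 cauchy_mul f' g'.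
Proof. by move=> ff' gg' M; apply: eq_bigr => i _; rewrite ff' gg'. Qed.

Lemma cauchy_mulC f g : cauchy_mul f g =1 cauchy_mul g f.
Proof. by move=> M; rewrite -!(coef_mul_truncated _ _ (leqnn M)) mulrC. Qed.

Lemma cauchy_mulA f g h :
  cauchy_mul f (cauchy_mul g h) =1 cauchy_mul (cauchy_mul f g) h.
Proof.
have coef_mul_mul f1 f2 f3 M : cauchy_mul (cauchy_mul f1 f2) f3 M =
    (\poly_(i < M.+1) f1 i * \poly_(i < M.+1) f2 i * \poly_(i < M.+1) f3 i)`_M.
  rewrite coefM; apply: eq_bigr => i _.
  by rewrite coef_mul_truncated -1?ltnS // coef_poly ltnS leq_subr.
by move=> M; rewrite cauchy_mulC !coef_mul_mul mulrC mulrA.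
Qed.

Lemma cauchy_mulDl f g h M :
  cauchy_mul (fun i => f i + g i) h M = cauchy_mul f h M + cauchy_mul g h M.
Proof. by rewrite -big_split; apply: eq_bigr => i _; rewrite mulrDl. Qed.

Lemma euler_cauchy_mul f g M : euler (cauchy_mul f g) M =
  cauchy_mul (euler f) g M + cauchy_mul f (euler g) M.
Proof.
rewrite /euler /cauchy_mul -sumrMnl -big_split; apply: eq_bigr => i _ /=.
by rewrite mulrnAl mulrnAr -mulrnDr subnKC // -ltnS.
Qed.

Lemma euler_dilate p f M : euler (dilate p f) M = dilate p (euler f) M *+ p.
Proof.
rewrite /euler /dilate; case: ifP => [dvd_pM|_]; last by rewrite !mul0rn.
by rewrite -mulrnA divnK.
Qed.

Lemma dilate_cauchy_mul p f g : (0 < p)%N ->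
  dilate p (cauchy_mul f g) =1 cauchy_mul (dilate p f) (dilate p g).
Proof.
move=> p_gt0 M.
have coef_dilate (h : nat -> R) i : (i <= M)%N ->
    (\poly_(i < M.+1) h i \Po 'X^p)`_i = dilate p h i.
  move=> le_iM; rewrite coef_comp_poly_Xn // coef_poly ltnS.
  by rewrite (leq_trans (leq_div _ _)).
rewrite {1}/dilate -(coef_mul_truncated f g (leq_div M p)).
rewrite -coef_comp_poly_Xn // comp_polyM coefM; apply: eq_bigr => i _.
by rewrite !coef_dilate ?leq_subr // -ltnS.
Qed.

Lemma cauchy_mul_dilate p f g P : (0 < p)%N ->
  cauchy_mul f (dilate p g) (p * P) =
    \sum_(N < P.+1) f (p * N)%N * g (P - N)%N.
Proof.
move=> p_gt0.
pose mulp (N : 'I_P.+1) : 'I_(p * P).+1 := inord (p * N).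
have mulpE N : mulp N = (p * N)%N :> nat.
  by rewrite inordK // ltnS leq_mul2l -ltnS ltn_ord orbT.
pose divp (i : 'I_(p * P).+1) : 'I_P.+1 := inord (i %/ p).
have divpE i : divp i = (i %/ p)%N :> nat.
  rewrite inordK // ltn_divLR // (leq_trans (ltn_ord i)) //.
  by rewrite mulSn [(P * p)%N]mulnC -add1n leq_add2r.
rewrite /cauchy_mul (bigID (fun i : 'I_(p * P).+1 => p %| i)%N) /=.
rewrite [X in _ + X]big1 ?addr0 => [|i ndvd_pi]; last first.
  by rewrite /dilate dvdn_subr -1?ltnS ?dvdn_mulr // (negPf ndvd_pi) mulr0.
rewrite (reindex_onto mulp divp) => [|i dvd_pi]; last first.
  by apply: val_inj; rewrite /= mulpE divpE mulnC divnK.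
apply: eq_big => [N|N _]; rewrite mulpE.
  by rewrite dvdn_mulr //=; apply/eqP/val_inj; rewrite /= divpE mulpE mulKn.
by rewrite /dilate -mulnBr dvdn_mulr // mulKn.
Qed.

(* The equation y f' = e f. *)
Definition has_log_deriv f e : Prop := euler f =1 cauchy_mul e f.

Lemma has_log_derivM f g d e : has_log_deriv f d -> has_log_deriv g e ->
  has_log_deriv (cauchy_mul f g) (fun i => d i + e i).
Proof.
move=> fd ge M; rewrite euler_cauchy_mul cauchy_mulDl; congr (_ + _).
  by rewrite cauchy_mulA; apply: eq_cauchy_mul.
rewrite cauchy_mulC (eq_cauchy_mul ge (frefl f)) -!cauchy_mulA.
by apply: eq_cauchy_mul => //; apply: cauchy_mulC.
Qed.

Lemma has_log_deriv_dilate p f e : (0 < p)%N -> has_log_deriv f e ->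
  has_log_deriv (dilate p f) (fun i => dilate p e i *+ p).
Proof.
move=> p_gt0 fe M; rewrite euler_dilate.
transitivity (dilate p (cauchy_mul e f) M *+ p).
  by rewrite /dilate fe.
rewrite dilate_cauchy_mul // /cauchy_mul -sumrMnl.
by apply: eq_bigr => i _; rewrite mulrnAl.
Qed.

Lemma has_log_deriv_unique f g e :
  (forall n, (0 < n)%N -> injective (fun x : R => x *+ n)) ->
  e 0%N = 0 -> f 0%N = g 0%N ->
  has_log_deriv f e -> has_log_deriv g e -> f =1 g.
Proof.
move=> mulrn_inj e0 fg0 fe ge; elim/ltn_ind=> -[//|M] IH.
apply: (mulrn_inj M.+1) => //.
rewrite -[LHS]/(euler f _) -[RHS]/(euler g _) fe ge.
rewrite /cauchy_mul big_ord_recl [RHS]big_ord_recl e0 !mul0r; congr (_ + _).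
by apply: eq_bigr => i _; rewrite IH // lift0 subSS ltnS leq_subr.
Qed.
End CauchyProduct.

(** * Rising factorials *)

Section Rising.
Variable A : comAlgType rat.
Implicit Types x y : A.

Lemma alg_nat_inj n : (0 < n)%N -> injective (fun x => x *+ n).
Proof.
move=> n_gt0 x y; rewrite -!scaler_nat => /(congr1 (GRing.scale n%:R^-1)).
by rewrite !scalerA mulVf ?scale1r // pnatr_eq0 -lt0n.
Qed.

(* The coefficient of y ^ M in (1 - y) ^ (- x). *)
Definition rising (M : nat) (x : A) : A :=
  M`!%:R^-1 *: \prod_(n < M) (x + n%:R).

Lemma rising0 x : rising 0 x = 1.
Proof. by rewrite /rising big_ord0 invr1 scale1r. Qed.

Lemma risingS M x : rising M.+1 x *+ M.+1 = (x + M%:R) * rising M x.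
Proof.
rewrite /rising big_ord_recr /= -scaler_nat scalerA factS natrM invfM mulVKf.
  by rewrite -scalerAr mulrC.
by rewrite pnatr_eq0.
Qed.

Lemma has_log_deriv_rising x :
  has_log_deriv (rising^~ x) (fun i => if i is 0 then 0 else x).
Proof.
elim=> [|M IH]; first by rewrite /euler /cauchy_mul big_ord1 mulr0n mul0r.
rewrite /euler risingS mulrDl mulr_natl -[_ *+ M]/(euler (rising^~ x) M) IH.
rewrite /cauchy_mul big_ord_recl [RHS]big_ord_recl big_ord_recl !mul0r !add0r.
by rewrite subSS subn0; congr (_ + _); apply: eq_bigr => i _; rewrite subSS.
Qed.

Lemma rising_natDl M m x : 'C(M + m, M)%:R *: rising (M + m) x =
  rising M x * rising m (x + M%:R).
Proof.
rewrite /rising -scalerAl -scalerAr !scalerA; congr (_ *: _).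
  have fact_neq0 n : n`!%:R != 0 :> rat by rewrite pnatr_eq0 -lt0n fact_gt0.
  have <- : ('C(M + m, M) * (M`! * m`!) = (M + m)`!)%N.
    by rewrite -[RHS](bin_fact (leq_addr m M)) addKn.
  by rewrite !natrM; field; rewrite !fact_neq0 pnatr_eq0 -lt0n bin_gt0 leq_addr.
rewrite big_split_ord; congr (_ * _); apply: eq_bigr => n _ /=.
by rewrite natrD addrA.
Qed.

(* The factor at n = 0 is 1, as 0%:R^-1 = 0. *)
Lemma rising_prod N x : (0 < N)%N ->
  rising N x = (N%:R^-1 *: x) * \prod_(n < N) (1 + n%:R^-1 *: x).
Proof.
have natmulV m y : (m.+1%:R^-1 *: y) *+ m.+1 = y.
  by rewrite -scaler_nat scalerA mulfV ?scale1r // pnatr_eq0.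
case: N => // N _; elim: N => [|N IH].
  rewrite -[LHS]mulr1n risingS rising0 big_ord1 invr0 invr1 scale0r scale1r.
  by rewrite !addr0 !mulr1.
apply: (alg_nat_inj (ltn0Sn N.+1)).
rewrite /= risingS {}IH [in RHS]big_ord_recr /= -[RHS]mulrnAl natmulV.
set u := _ *: x; have -> : x = u *+ N.+1 by rewrite natmulV.
by rewrite -mulrnDl !mulrnAl; congr (_ *+ _); ring.
Qed.

Lemma rising_nat M c : rising M (c.+1%:R : A) = 'C(M + c, c)%:R.
Proof.
have prod_ffact : \prod_(n < M) (c.+1%:R + n%:R) = ((M + c) ^_ M)%:R :> A.
  elim: M => [|M IH]; first by rewrite big_ord0 ffactn0.
  by rewrite big_ord_recr /= IH addSn ffactSS natrM mulrC -natrD addSn addnC.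
rewrite /rising prod_ffact -bin_ffact natrM -bin_sub ?leq_addr // addKn.
rewrite mulr_natr -scaler_nat scalerA mulVf ?scale1r //.
by rewrite pnatr_eq0 -lt0n fact_gt0.
Qed.

Lemma rising_at0 M : (0 < M)%N -> rising M (0 : A) = 0.
Proof.
by case: M => // M _; rewrite /rising big_ord_recl addr0 mul0r scaler0.
Qed.

(* The Chu-Vandermonde identity: (1 - y) ^ (- x) (1 - y) ^ (- z) =
   (1 - y) ^ (- (x + z)). *)
Lemma rising_add x z :
  rising^~ (x + z) =1 cauchy_mul (rising^~ x) (rising^~ z).
Proof.
apply: (has_log_deriv_unique alg_nat_inj _ _ (has_log_deriv_rising (x + z)))
  => // [|M]; first by rewrite /cauchy_mul big_ord1 !rising0 mulr1.
rewrite (has_log_derivM (has_log_deriv_rising x) (has_log_deriv_rising z)).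
by apply: eq_cauchy_mul => // -[|i] //; rewrite addr0.
Qed.

Lemma sum_rising_bin x P c :
  \sum_(N < P.+1) (rising N x * rising (P - N) (- x)) *+ 'C(N, c) =
  if (c <= P)%N then rising c x * rising (P - c) c%:R else 0.
Proof.
case: leqP => [le_cP|lt_Pc]; last first.
  by apply: big1 => N _; rewrite bin_small // (leq_trans (ltn_ord N)).
rewrite -(big_mkord xpredT
  (fun N => rising N x * rising (P - N) (- x) *+ 'C(N, c))).
rewrite (big_cat_nat (n := c)) //=; last exact: leqW.
rewrite big_nat_cond big1 ?add0r => [|N]; last first.
  by rewrite andbT => /andP[_ lt_Nc]; rewrite bin_small.
rewrite -{1}[c]add0n big_addn big_mkord subSn //.
have -> : c%:R = x + c%:R + - x by rewrite addrC addKr.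
rewrite rising_add mulr_sumr; apply: eq_bigr => i _.
rewrite [RHS]mulrA -rising_natDl subnDA addnC [(P - _ - c)%N]subnAC.
by rewrite -[RHS]scalerAl scaler_nat.
Qed.

Definition rising_conv x (P : nat) (W : nat -> A) : A :=
  \sum_(N < P.+1) rising N x * rising (P - N) (- x) * W N.

Lemma rising_convB x P W W' :
  rising_conv x P (fun N => W N - W' N) =
    rising_conv x P W - rising_conv x P W'.
Proof. by rewrite -sumrB; apply: eq_bigr => N _; rewrite mulrBr. Qed.
End Rising.

Arguments rising {A} M x.

(** * The generating function of C_{r,k,p} *)

Lemma coef_exp_poly (R : comNzRingType) D k (f : nat -> R) M :
  ((\poly_(i < D) f i) ^+ k)`_M =
  \sum_(n : {ffun 'I_k -> 'I_D} | (\sum_(i < k) n i)%N == M)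
     \prod_(i < k) f (n i).
Proof.
rewrite -[k in _ ^+ k]card_ord -prodr_const.
under eq_bigr do rewrite poly_def.
rewrite bigA_distr_bigA coef_sum [RHS]big_mkcond; apply: eq_bigr => n _ /=.
rewrite scaler_prod -expr_sum coefZ coefXn eq_sym.
by case: eqP => _; rewrite ?mulr1 ?mulr0.
Qed.

Lemma coef_exp_euler (R : comNzRingType) (q : {poly R}) k M :
  (q ^+ k.+1)`_M *+ M =
  cauchy_mul (euler (nth 0 q)) (nth 0 (q ^+ k)) M *+ k.+1.
Proof.
have coef_euler (u : {poly R}) m : ('X * u^`())`_m = u`_m *+ m.
  by rewrite coefXM; case: m => [|m] //=; rewrite coef_deriv.
rewrite -coef_euler deriv_exp mulrnAr mulrA coefMn coefM; congr (_ *+ _).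
by apply: eq_bigr => i _; rewrite coef_euler.
Qed.

Section ExponentialFormula.
Variables (F : numFieldType) (ell : nat -> F) (Y : nat -> {poly F}).
Hypothesis ell0 : ell 0 = 0.
Hypothesis Y0 : Y 0 = 1.
Hypothesis Y_log_deriv : has_log_deriv Y (fun i => euler ell i *: 'X).

Lemma coef_log_deriv k M : (Y M)`_k *+ M =
  if k is k'.+1 then cauchy_mul (euler ell) (fun m => (Y m)`_k') M else 0.
Proof.
rewrite -coefMn -[_ *+ M]/(euler Y M) Y_log_deriv coef_sum.
case: k => [|k]; last by apply: eq_bigr => i _; rewrite -scalerAl coefZ coefXM.
by apply: big1 => i _; rewrite -scalerAl coefZ coefXM mulr0.
Qed.

(* Y is the exponential of t times the series ell, so its coefficient of t ^ k
   is the k-th power of ell divided by k!. *)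
Lemma coef_exp_log_deriv D k M : (M <= D)%N ->
  ((\poly_(i < D.+1) ell i) ^+ k)`_M = (Y M)`_k *+ k`!.
Proof.
elim: k M => [|k IHk] [|M] le_MD; rewrite ?Y0 ?expr0 ?coef1 //.
- by apply: (pmulrnI (ltn0Sn M)); rewrite /= mul0rn coef_log_deriv.
- by rewrite exprS coef0M coef_poly ell0 mul0r mul0rn.
apply: (pmulrnI (ltn0Sn M)); rewrite /= coef_exp_euler factS mulnC.
rewrite [RHS]mulrnAC coef_log_deriv mulrnA; congr (_ *+ _).
rewrite /cauchy_mul -sumrMnl; apply: eq_bigr => i _.
have le_iM : (i <= M.+1)%N by rewrite -ltnS.
rewrite IHk ?(leq_trans (leq_subr _ _)) // mulrnAr /euler coef_poly ltnS.
by rewrite (leq_trans le_iM).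
Qed.
End ExponentialFormula.

(* The coefficients of log (1 - y ^ p) / p - log (1 - y). *)
Definition prime_to_inv (p n : nat) : rat := if (p %| n)%N then 0 else n%:R^-1.

Lemma prime_to_inv1 p : prime p -> prime_to_inv p 1 = 1.
Proof. by move=> pr; rewrite /prime_to_inv Euclid_dvd1 // invr1. Qed.

Lemma prime_to_invM p m n : prime p ->
  prime_to_inv p (m * n) = prime_to_inv p m * prime_to_inv p n.
Proof.
move=> pr; rewrite /prime_to_inv Euclid_dvdM // natrM invfM.
by case: (p %| m)%N; case: (p %| n)%N; rewrite ?mul0r ?mulr0.
Qed.

Lemma Csum_coef r k p : prime p ->
  Csum r k p = ((\poly_(i < (p ^ r).+1) prime_to_inv p i) ^+ k)`_(p ^ r).
Proof.
move=> pr; rewrite coef_exp_poly /Csum big_mkcond [RHS]big_mkcond /=.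
apply: eq_bigr => n _; rewrite andbCA; case: eqP => //= _.
have morphM x y := prime_to_invM x y pr.
rewrite -(big_morph _ morphM (prime_to_inv1 pr)) /prime_to_inv.
case: (boolP (p %| _)%N) => [_|ndvd]; first by rewrite andbF.
rewrite natr_prod ifT // andbT; apply/forallP => i; rewrite lt0n.
by apply: contra ndvd => /eqP ni0; rewrite (bigD1 i) //= ni0 mul0n dvdn0.
Qed.

Definition X_over (p : nat) : {poly rat} := p%:R^-1 *: 'X.

(* The coefficients of (1 - y ^ p) ^ (t / p) (1 - y) ^ (- t), for t = 'X. *)
Definition C_series (p : nat) : nat -> {poly rat} :=
  cauchy_mul (rising^~ 'X) (dilate p (rising^~ (- X_over p))).

Lemma has_log_deriv_C_series p : (0 < p)%N ->
  has_log_deriv (C_series p) (fun i => euler (prime_to_inv p) i *: 'X).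
Proof.
move=> p_gt0 M; rewrite (has_log_derivM (has_log_deriv_rising 'X)
  (has_log_deriv_dilate p_gt0 (has_log_deriv_rising (- X_over p)))).
apply: eq_cauchy_mul => // -[|i]; rewrite /euler /dilate /prime_to_inv.
  by rewrite dvdn0 div0n !mul0rn addr0 scale0r.
have [/dvdnP[[//|q] ->]|_] := boolP (p %| i.+1)%N; last first.
  by rewrite mul0rn addr0 -[_^-1 *+ _]mulr_natr mulVf ?pnatr_eq0 // scale1r.
rewrite mulnK // mul0rn scale0r mulNrn -scaler_nat scalerA mulfV.
  by rewrite scale1r subrr.
by rewrite pnatr_eq0 -lt0n.
Qed.

Lemma Csum_C_series r k p :
  prime p -> Csum r k p = (C_series p (p ^ r))`_k *+ k`!.
Proof.
move=> pr; have p_gt0 := prime_gt0 pr; rewrite Csum_coef //.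
apply: coef_exp_log_deriv => //; last exact: has_log_deriv_C_series.
- by rewrite /prime_to_inv dvdn0.
- by rewrite /C_series /cauchy_mul big_ord1 /dilate dvdn0 div0n !rising0 mulr1.
Qed.

(* This is W_N when f a j is 1 / (a + p j). *)
Definition residue_product (p : nat) (f : nat -> nat -> rat) (N : nat) :
    {poly rat} :=
  \prod_(j < N) \prod_(a < p.-1) (1 + f a.+1 j *: 'X).

Definition residue_inv (p a j : nat) : rat := (a + p * j)%:R^-1.

Lemma prod_mul_ord (R : comNzRingType) p N (f : nat -> R) : (0 < p)%N ->
  \prod_(n < p * N) f n =
    \prod_(j < N) (f (p * j)%N * \prod_(a < p.-1) f (a.+1 + p * j)%N).
Proof.
case: p => // p _; rewrite -(big_mkord xpredT f) mulnC big_nat_mul big_mkord.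
apply: eq_bigr => j _; rewrite -{1}[(j * _)%N]add0n big_addn mulSn addnK.
by rewrite big_mkord big_ord_recl mulnC.
Qed.

Lemma rising_mul p N : (0 < p)%N ->
  rising (p * N) 'X = rising N (X_over p) * residue_product p (residue_inv p) N.
Proof.
move=> p_gt0; have [->|N_gt0] := posnP N.
  by rewrite muln0 !rising0 /residue_product big_ord0 mulr1.
rewrite !rising_prod ?muln_gt0 ?p_gt0 //.
rewrite (prod_mul_ord N (fun n => 1 + n%:R^-1 *: 'X)) // big_split /= mulrA.
rewrite /X_over !scalerA natrM invfM [p%:R^-1 * _]mulrC; congr (_ * _ * _).
by apply: eq_bigr => j _; rewrite natrM invfM scalerA mulrC.
Qed.

Lemma Csum_rising_conv r k p : prime p ->
  Csum r.+1 k p =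
  (rising_conv (X_over p) (p ^ r) (residue_product p (residue_inv p)))`_k
    *+ k`!.
Proof.
move=> pr; have p_gt0 := prime_gt0 pr; rewrite Csum_C_series // expnS.
rewrite /C_series cauchy_mul_dilate //; congr (_`_k *+ _); congr polyseq.
by apply: eq_bigr => N _; rewrite rising_mul // mulrAC.
Qed.

(** * Finite differences *)

Section FiniteDifferences.
Variable R : comNzRingType.
Implicit Types (f g : nat -> R) (q : nat -> {poly R}).

Definition fdiff f (N : nat) : R := f N.+1 - f N.

(* Equivalently, f N is a combination of 'C(N, c), c <= K. *)
Definition fdegree_le (K : nat) f : Prop := iter K.+1 fdiff f =1 fun=> 0.

Lemma eq_iter_fdiff c f g : f =1 g -> iter c fdiff f =1 iter c fdiff g.
Proof. by move=> fg; elim: c => //= c IH N; rewrite /fdiff !IH. Qed.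

Lemma iter_fdiff0 c : iter c fdiff (fun=> 0) =1 fun=> 0.
Proof. by elim: c => //= c IH N; rewrite /fdiff !IH subr0. Qed.

Lemma iter_fdiffD c f g N : iter c fdiff (fun N => f N + g N) N =
  iter c fdiff f N + iter c fdiff g N.
Proof. by elim: c N => //= c IH N; rewrite /fdiff !IH addrACA opprD. Qed.

Lemma iter_fdiffZ c x f N :
  iter c fdiff (fun N => x * f N) N = x * iter c fdiff f N.
Proof. by elim: c N => //= c IH N; rewrite /fdiff !IH mulrBr. Qed.

Lemma iter_fdiff_shift c f N :
  iter c fdiff (fun N => f N.+1) N = iter c fdiff f N.+1.
Proof. by elim: c N => //= c IH N; rewrite /fdiff !IH. Qed.

Lemma iter_fdiff_bin c f N : iter c fdiff f N =
  \sum_(i < c.+1) (-1) ^+ (c - i) * 'C(c, i)%:R * f (N + i)%N.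
Proof.
elim: c N => [|c IH] N; first by rewrite /= big_ord1 addn0 !mul1r.
have -> : \sum_(i < c.+2) (-1) ^+ (c.+1 - i) * 'C(c.+1, i)%:R * f (N + i)%N =
   \sum_(i < c.+2) (-1) ^+ (c.+1 - i) * 'C(c, i)%:R * f (N + i)%N +
   \sum_(i < c.+1) (-1) ^+ (c - i) * 'C(c, i)%:R * f (N.+1 + i)%N.
  rewrite big_ord_recl [in RHS]big_ord_recl /= !bin0 -addrA; congr (_ + _).
  rewrite -big_split; apply: eq_bigr => i _ /=.
  by rewrite /bump add1n subSS binS natrD addSnnS mulrDr mulrDl.
rewrite /= /fdiff !IH addrC; congr (_ + _).
rewrite [RHS]big_ord_recr /= bin_small // mulr0 mul0r addr0 -sumrN.
apply: eq_bigr => i _; rewrite subSn -1?ltnS // exprS.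
by rewrite mulN1r !mulNr.
Qed.

Lemma eq_fdegree_le K f g : f =1 g -> fdegree_le K f -> fdegree_le K g.
Proof. by move=> fg df N; rewrite -(eq_iter_fdiff _ fg) df. Qed.

Lemma fdegree_leW K L f : (K <= L)%N -> fdegree_le K f -> fdegree_le L f.
Proof.
move=> leKL df N; rewrite -(subnK (leKL : K.+1 <= L.+1)%N) iterD.
by rewrite (eq_iter_fdiff _ df) iter_fdiff0.
Qed.

Lemma fdegree_le_cst x K : fdegree_le K (fun=> x).
Proof. by apply: (fdegree_leW (leq0n K)) => N; rewrite /= /fdiff subrr. Qed.

Lemma fdegree_le0 f : fdegree_le 0 f -> f =1 fun=> f 0%N.
Proof.
move=> df; elim=> // N <-; apply/eqP; rewrite -subr_eq0; exact/eqP/df.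
Qed.

Lemma fdegree_leD K f g :
  fdegree_le K f -> fdegree_le K g -> fdegree_le K (fun N => f N + g N).
Proof. by move=> df dg N; rewrite iter_fdiffD df dg addr0. Qed.

Lemma fdegree_leZ K x f : fdegree_le K f -> fdegree_le K (fun N => x * f N).
Proof. by move=> df N; rewrite iter_fdiffZ df mulr0. Qed.

Lemma fdegree_le_sum K n (F : nat -> nat -> R) :
  (forall i, (i < n)%N -> fdegree_le K (F i)) ->
  fdegree_le K (fun N => \sum_(i < n) F i N).
Proof.
elim: n => [|n IH] dF.
  apply: (eq_fdegree_le (fun N => esym (big_ord0 _ _ _ _))).
  exact: fdegree_le_cst.
apply: (eq_fdegree_le (fun N => esym (big_ord_recr _ _))).
by apply: fdegree_leD; [apply: IH => i lt_in; apply/dF/leqW|apply: dF].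
Qed.

Lemma fdegree_le_fdiff K f : fdegree_le K (fdiff f) <-> fdegree_le K.+1 f.
Proof. by split=> df N; have := df N; rewrite -iterSr. Qed.

Lemma fdegree_leM K L f g : fdegree_le K f -> fdegree_le L g ->
  fdegree_le (K + L) (fun N => f N * g N).
Proof.
have [n] := ubnP (K + L); elim: n => // n IH in K L f g *.
case: K => [|K] le_n df dg.
  apply: (eq_fdegree_le (f := fun N => f 0%N * g N)); last exact: fdegree_leZ.
  by move=> N; rewrite (fdegree_le0 df N).
case: L => [|L] in le_n dg *.
  rewrite addn0; apply: (eq_fdegree_le (f := fun N => g 0%N * f N)).
    by move=> N; rewrite (fdegree_le0 dg N) mulrC.
  exact: fdegree_leZ.
rewrite addSn; apply/fdegree_le_fdiff; apply: (eq_fdegree_le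
  (f := fun N => fdiff f N * g N.+1 + f N * fdiff g N)) => [N|].
  by rewrite /fdiff; ring.
apply: fdegree_leD.
  apply: IH => [||N]; [by lia | exact/fdegree_le_fdiff |].
  by rewrite iter_fdiff_shift dg.
by rewrite -addSnnS; apply: IH => //; [lia | apply/fdegree_le_fdiff].
Qed.

Lemma fdegree_le_exp x b : fdegree_le b (fun j => (x * j%:R) ^+ b).
Proof.
elim: b => [|b IH]; first exact: fdegree_le_cst.
apply: (eq_fdegree_le (fun j => esym (exprS (x * j%:R) b))); rewrite -add1n.
by apply: fdegree_leM => // N; rewrite /= /fdiff -!natr1; ring.
Qed.

Lemma newton_forward K f N : fdegree_le K f ->
  f N = \sum_(c < K.+1) 'C(N, c)%:R * iter c fdiff f 0.
Proof.
elim: N f => [|N IH] f df.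
  rewrite big_ord_recl mul1r big1 ?addr0 // => i _.
  by rewrite bin0n mul0r.
have dfS : fdegree_le K (fdiff f) by apply/fdegree_le_fdiff/(fdegree_leW _ df).
have -> : f N.+1 = f N + fdiff f N by rewrite /fdiff addrC subrK.
rewrite (IH f df) (IH _ dfS) [X in _ + X]big_ord_recr /= -iterSr df mulr0 addr0.
rewrite big_ord_recl [RHS]big_ord_recl !bin0 -addrA; congr (_ + _).
rewrite -big_split; apply: eq_bigr => i _ /=.
by rewrite /bump add1n binS natrD mulrDl -iterSr.
Qed.

Definition graded_fdegree_le (E : nat) q : Prop :=
  forall m, fdegree_le (m * E) (fun N => (q N)`_m).

Lemma graded_fdegree_le1 E : graded_fdegree_le E (fun=> 1).
Proof. by move=> m; apply: fdegree_le_cst. Qed.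

Lemma graded_fdegree_leM E q1 q2 :
  graded_fdegree_le E q1 -> graded_fdegree_le E q2 ->
  graded_fdegree_le E (fun N => q1 N * q2 N).
Proof.
move=> d1 d2 m; apply: (eq_fdegree_le (fun N => esym (coefM _ _ _))).
apply: (fdegree_le_sum
  (F := fun i N => (q1 N)`_i * (q2 N)`_(m - i))) => i le_im.
by rewrite -(subnKC (le_im : (i <= m)%N)) mulnDl addKn; apply: fdegree_leM.
Qed.

Lemma graded_fdegree_le_linear E f :
  fdegree_le E f -> graded_fdegree_le E (fun N => 1 + f N *: 'X).
Proof.
move=> df m; apply: (eq_fdegree_le (f := fun N =>
  (1 : {poly R})`_m + f N * (m == 1%N)%:R)) => [N|].
  by rewrite coefD coefZ coefX.
apply: fdegree_leD; first exact: fdegree_le_cst.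
case: eqP => [->|_]; rewrite ?mul1n.
  by apply: eq_fdegree_le df => N; rewrite mulr1.
by apply: eq_fdegree_le (fdegree_le_cst 0 _) => N; rewrite mulr0.
Qed.

Lemma graded_fdegree_le_prod E n (Q : nat -> nat -> {poly R}) :
  (forall a, graded_fdegree_le E (Q a)) ->
  graded_fdegree_le E (fun N => \prod_(a < n) Q a N).
Proof.
move=> dQ; elim: n => [|n IH] m.
  by apply: (eq_fdegree_le _ (graded_fdegree_le1 E m)) => N; rewrite big_ord0.
apply: (eq_fdegree_le _ (graded_fdegree_leM IH (dQ n) m)) => N.
by rewrite big_ord_recr.
Qed.

(* The difference of the coefficient of X ^ m only involves lower coefficients
   of the product, whence the loss of one degree for each of them. *)
Lemma graded_fdegree_le_iterated_prod E q :
  (forall N, (q N)`_0 = 1) -> graded_fdegree_le E q ->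
  graded_fdegree_le E.+1 (fun N => \prod_(j < N) q j).
Proof.
move=> q0 dq; elim/ltn_ind=> m IH.
have fdiff_coef N : \sum_(l < m) (\prod_(j < N) q j)`_l * (q N)`_(m - l) =
    fdiff (fun N => (\prod_(j < N) q j)`_m) N.
  by rewrite /fdiff big_ord_recr coefM big_ord_recr /= subnn q0 mulr1 addrK.
case: m => [|m] in IH fdiff_coef *.
  by move=> N; rewrite /= -fdiff_coef big_ord0.
rewrite mulSn addSn; apply/fdegree_le_fdiff/(eq_fdegree_le fdiff_coef).
apply: (fdegree_le_sum
  (F := fun l N => (\prod_(j < N) q j)`_l * (q N)`_(m.+1 - l))) => l lt_lm.
apply: fdegree_leW (fdegree_leM (IH l lt_lm) (dq (m.+1 - l)%N)).
rewrite mulnS -addnA -mulnDl subnKC ?(ltnW lt_lm) // mulSn mulnS addnCA.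
by rewrite leq_add2l leq_add2r.
Qed.
End FiniteDifferences.

Arguments fdiff {R} f N.

Lemma coef_iter_fdiff (R : comNzRingType) c (q : nat -> {poly R}) N m :
  (iter c fdiff q N)`_m = iter c fdiff (fun n => (q n)`_m) N.
Proof. by elim: c N => //= c IH N; rewrite /fdiff coefB !IH. Qed.

Lemma rising_conv_newton (A : comAlgType rat) (x : A) P K (W : nat -> A) :
  (0 < P)%N -> fdegree_le K W -> rising_conv x P W =
  \sum_(c < K) 'C(P.-1, c)%:R * rising c.+1 x * iter c.+1 fdiff W 0.
Proof.
move=> P_gt0 dW; rewrite /rising_conv.
under eq_bigr => N _ do rewrite (newton_forward N dW) mulr_sumr.
rewrite exchange_big /=.
have sum_over_N c : \sum_(N < P.+1)
    rising N x * rising (P - N) (- x) * ('C(N, c)%:R * iter c fdiff W 0) =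
  (if (c <= P)%N then rising c x * rising (P - c) c%:R else 0)
  * iter c fdiff W 0.
  rewrite -sum_rising_bin mulr_suml; apply: eq_bigr => N _.
  by rewrite mulrA mulr_natr.
under eq_bigr do rewrite sum_over_N.
rewrite big_ord_recl subn0 rising_at0 // mulr0 mul0r add0r.
apply: eq_bigr => c _; rewrite lift0; congr (_ * _).
case: ltnP => [lt_cP|le_Pc]; last by rewrite bin_small ?prednK // mul0r.
by rewrite rising_nat mulrC; congr (_%:R * _); congr 'C(_, _); lia.
Qed.

Lemma coefM_take_poly (R : comNzRingType) (u v : {poly R}) k :
  (u * take_poly k.+1 v)`_k = (u * v)`_k.
Proof.
by rewrite !coefM; apply: eq_bigr => i _; rewrite coef_take_poly ltnS leq_subr.
Qed.

Lemma coef_rising_conv_newton (x : {poly rat}) P k K (W : nat -> {poly rat}) :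
  (0 < P)%N -> (forall m, (m <= k)%N -> fdegree_le K (fun N => (W N)`_m)) ->
  (rising_conv x P W)`_k =
  (\sum_(c < K) 'C(P.-1, c)%:R * rising c.+1 x * iter c.+1 fdiff W 0)`_k.
Proof.
move=> P_gt0 dW; pose Wk N := take_poly k.+1 (W N).
have iter_fdiff_take c N :
    iter c fdiff Wk N = take_poly k.+1 (iter c fdiff W N).
  by elim: c N => //= c IH N; rewrite /fdiff !IH linearB.
have dWk : fdegree_le K Wk.
  move=> N; rewrite iter_fdiff_take; apply/polyP => m.
  rewrite coef_take_poly coef0; case: ifP => // le_mk.
  by rewrite coef_iter_fdiff dW.
have -> : (rising_conv x P W)`_k = (rising_conv x P Wk)`_k.
  by rewrite !coef_sum; apply: eq_bigr => N _; rewrite coefM_take_poly.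
rewrite (rising_conv_newton x P_gt0 dWk) !coef_sum; apply: eq_bigr => c _.
by rewrite iter_fdiff_take coefM_take_poly.
Qed.

Lemma coef0_prod_linear (R : comNzRingType) n (f : nat -> R) :
  (\prod_(a < n) (1 + f a *: 'X))`_0 = 1.
Proof.
elim: n => [|n IH]; first by rewrite big_ord0 coef1.
by rewrite big_ord_recr coef0M IH coefD coef1 coefZ coefX mulr0 addr0 mulr1.
Qed.

Lemma graded_residue_product p E (f : nat -> nat -> rat) :
  (forall a, fdegree_le E (f a)) ->
  graded_fdegree_le E.+1 (residue_product p f).
Proof.
move=> df; apply: (graded_fdegree_le_iterated_prod
  (q := fun j => \prod_(a < p.-1) (1 + f a.+1 j *: 'X))) => [N|].
  exact: (coef0_prod_linear p.-1 (fun a => f a.+1 N)).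
apply: (graded_fdegree_le_prod p.-1 (Q := fun a j => 1 + f a.+1 j *: 'X)) => a.
exact: graded_fdegree_le_linear.
Qed.

Definition truncated_inv (p E a j : nat) : rat :=
  \sum_(b < E) (- j%:R) ^+ b * p%:R ^+ b / a%:R ^+ b.+1.

Lemma fdegree_le_truncated_inv p E a : fdegree_le E (truncated_inv p E.+1 a).
Proof.
apply: (fdegree_le_sum (F := fun b j =>
  (- j%:R) ^+ b * p%:R ^+ b / a%:R ^+ b.+1)) => b lt_bE.
apply: (eq_fdegree_le
  (f := fun j => (p%:R ^+ b / a%:R ^+ b.+1) * (-1 * j%:R) ^+ b)) => [j|].
  by rewrite mulN1r mulrC mulrA.
exact/fdegree_leZ/(fdegree_leW (lt_bE : (b <= E)%N))/fdegree_le_exp.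
Qed.

(** * Integrality at p *)

Definition p_integral (p : nat) : {pred rat} :=
  [pred x | coprime p `|denq x|].

Lemma dvdn_denq (a : int) (b : nat) (x : rat) :
  x * b%:R = a%:~R -> (`|denq x| %| b)%N.
Proof.
move=> xb; have numx_b : numq x * b%:Z = a * denq x.
  apply: (@intr_inj rat); rewrite !intrM numqE -xb /=.
  by rewrite mulrAC.
have : (`|denq x| %| `|numq x| * b)%N.
  by rewrite -[b]absz_nat -abszM numx_b abszM dvdn_mull.
by rewrite Gauss_dvdr // coprime_sym coprime_num_den.
Qed.

Lemma p_integral_frac p (a : int) (b : nat) :
  coprime p b -> a%:~R / b%:R \in p_integral p.
Proof.
have [->|b_neq0] := eqVneq b 0%N; first by rewrite invr0 mulr0 inE coprimen1.
move=> co_pb; rewrite inE (coprime_dvdr _ co_pb) //.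
by apply: (dvdn_denq (a := a)); rewrite divfK ?pnatr_eq0.
Qed.

Lemma p_integralP p x :
  reflect (exists a b, [/\ coprime p b, b != 0%N & x = a%:~R / b%:R])
          (x \in p_integral p).
Proof.
apply: (iffP idP) => [x_int|[a [b [co_pb _ ->]]]]; last exact: p_integral_frac.
exists (numq x), `|denq x|%N; split=> //; first by rewrite absz_eq0 denq_neq0.
by rewrite -[LHS]divq_num_den -[in LHS]absz_denq.
Qed.

Fact p_integral_subring p : subring_closed (p_integral p).
Proof.
split=> [|x y|x y]; first exact: coprimen1.
- move=> /p_integralP[a [b [co_b b0 ->]]] /p_integralP[c [d [co_d d0 ->]]].
  have -> : a%:~R / b%:R - c%:~R / d%:R =
      (a * d%:Z - c * b%:Z)%:~R / (b * d)%:R :> rat.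
    by rewrite -mulNr addf_div ?pnatr_eq0 // intrB !intrM natrM mulNr.
  by apply: p_integral_frac; rewrite coprimeMr co_b.
- move=> /p_integralP[a [b [co_b b0 ->]]] /p_integralP[c [d [co_d d0 ->]]].
  rewrite mulf_div -intrM -natrM.
  by apply: p_integral_frac; rewrite coprimeMr co_b.
Qed.

HB.instance Definition _ p :=
  GRing.isSubringClosed.Build rat (p_integral p) (p_integral_subring p).

Lemma p_integral_inv p n : coprime p n -> n%:R^-1 \in p_integral p.
Proof. by move=> co_pn; rewrite -div1r (p_integral_frac 1). Qed.

Lemma rat_congr_p_integral p n x y : (0 < p)%N ->
  (x - y) / p%:R ^+ n \in p_integral p -> rat_congr (p ^ n) x y.
Proof.
rewrite /rat_congr; set z := x - y => p_gt0 /p_integralP[a [b [co_pb b0 zE]]].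
have pn_neq0 : p%:R ^+ n != 0 :> rat by rewrite expf_neq0 // pnatr_eq0 -lt0n.
have numz : numq z * b%:Z = (p ^ n)%N%:Z * a * denq z.
  apply: (@intr_inj rat); rewrite !intrM numqE -!pmulrn natrX.
  by rewrite -[z](divfK pn_neq0) zE; field; rewrite pnatr_eq0.
have : ((p ^ n)%N%:Z %| numq z * b%:Z)%Z by rewrite numz -mulrA dvdz_mulr.
by rewrite Gauss_dvdzl // /coprimez /gcdz /= eqz_nat; apply: coprimeXl.
Qed.

Lemma p_integral_expn_div p s n : prime p -> (0 < n)%N -> (n <= p ^ s)%N ->
  p%:R ^+ s / n%:R \in p_integral p.
Proof.
move=> pr n_gt0 le_n; have [m co_pm nE] := pfactor_coprime pr n_gt0.
have le_s : (logn p n <= s)%N.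
  rewrite -(leq_exp2l _ _ (prime_gt1 pr)) (leq_trans _ le_n) //.
  by rewrite dvdn_leq ?pfactor_dvdnn.
have pX_neq0 : p%:R ^+ logn p n != 0 :> rat.
  by rewrite expf_neq0 // pnatr_eq0 -lt0n prime_gt0.
rewrite [in n%:R]nE natrM natrX -(subnK le_s) exprD -mulf_div.
rewrite mulfV // mulr1.
by apply: rpredM; [apply/rpredX/rpred_nat | apply: p_integral_inv].
Qed.

Section ScaledIntegrality.
Variables p r : nat.
Implicit Types (q : {poly rat}) (E : nat).

Definition scaled_integral E q : bool :=
  p%:R ^- E *: (q \Po (p%:R ^+ r *: 'X)) \is a polyOver (p_integral p).

Lemma coef_comp_poly_scaleX (c : rat) q i :
  (q \Po (c *: 'X))`_i = c ^+ i * q`_i.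
Proof.
rewrite comp_polyE coef_sum.
under eq_bigr => j _ do rewrite coefZ exprZn coefZ coefXn.
have [lt_iq|le_qi] := ltnP i (size q).
  rewrite (bigD1 (Ordinal lt_iq)) //= eqxx mulr1 big1 ?addr0 1?mulrC // => j.
  by rewrite -val_eqE /= eq_sym => /negPf ->; rewrite !mulr0.
rewrite nth_default // mulr0 big1 // => j _.
by rewrite gtn_eqF ?mulr0 // (leq_trans (ltn_ord j)).
Qed.

Lemma scaled_integral_coef E q i : scaled_integral E q ->
  (p%:R ^+ r) ^+ i * q`_i / p%:R ^+ E \in p_integral p.
Proof.
by move=> /polyOverP/(_ i); rewrite coefZ coef_comp_poly_scaleX mulrC.
Qed.

Lemma scaled_integralM E q1 q2 : scaled_integral 0 q1 ->
  scaled_integral E q2 -> scaled_integral E (q1 * q2).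
Proof.
rewrite /scaled_integral expr0 invr1 scale1r comp_polyM => q1_int q2_int.
by rewrite scalerAr rpredM.
Qed.

Lemma scaled_integralD E q1 q2 : scaled_integral E q1 ->
  scaled_integral E q2 -> scaled_integral E (q1 + q2).
Proof.
by move=> q1_int q2_int; rewrite /scaled_integral comp_polyD scalerDr rpredD.
Qed.

Lemma scaled_integral0 E : scaled_integral E 0.
Proof. by rewrite /scaled_integral comp_poly0 scaler0 rpred0. Qed.

Lemma scaled_integral1 : scaled_integral 0 1.
Proof. by rewrite /scaled_integral expr0 invr1 scale1r comp_polyC rpred1. Qed.

Lemma scaled_integralZX E c : p%:R ^+ r * c / p%:R ^+ E \in p_integral p ->
  scaled_integral E (c *: 'X).
Proof.
move=> c_int; rewrite /scaled_integral comp_polyZ comp_polyX !scalerA.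
by rewrite polyOverZ ?polyOverX // mulrC [c * _]mulrC.
Qed.

Definition scaled_congr E q1 q2 : Prop :=
  [/\ scaled_integral 0 q1, scaled_integral 0 q2 & scaled_integral E (q1 - q2)].

Lemma scaled_congr1 E : scaled_congr E 1 1.
Proof. by split; rewrite ?subrr ?scaled_integral0 ?scaled_integral1. Qed.

Lemma scaled_congrM E q1 q2 q3 q4 : scaled_congr E q1 q2 ->
  scaled_congr E q3 q4 -> scaled_congr E (q1 * q3) (q2 * q4).
Proof.
move=> [i1 i2 d12] [i3 i4 d34]; split; try exact: scaled_integralM.
have -> : q1 * q3 - q2 * q4 = q1 * (q3 - q4) + q4 * (q1 - q2) by ring.
by apply: scaled_integralD; apply: scaled_integralM.
Qed.

Lemma scaled_congr_linear E x y : x \in p_integral p -> y \in p_integral p ->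
  (x - y) / p%:R ^+ E \in p_integral p ->
  scaled_congr E (1 + x *: 'X) (1 + y *: 'X).
Proof.
have integral_linear z : z \in p_integral p -> scaled_integral 0 (1 + z *: 'X).
  move=> z_int; apply: scaled_integralD scaled_integral1 (scaled_integralZX _).
  by rewrite expr0 divr1 rpredM ?rpredX ?rpred_nat.
move=> x_int y_int xy_int; split; try exact: integral_linear.
have -> : 1 + x *: 'X - (1 + y *: 'X) = (x - y) *: 'X by rewrite scalerBl; ring.
by apply: scaled_integralZX; rewrite -mulrA rpredM ?rpredX ?rpred_nat.
Qed.
End ScaledIntegrality.

Lemma scaled_integral_rising p r N c : prime p -> (N <= p ^ r)%N ->
  c \in p_integral p -> scaled_integral p r.+1 0 (rising N (c *: X_over p)).
Proof.
move=> pr le_N c_int; have [->|N_gt0] := posnP N.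
  by rewrite rising0 scaled_integral1.
have p_neq0 : p%:R != 0 :> rat by rewrite pnatr_eq0 -lt0n prime_gt0.
have integral_factor n : (n <= p ^ r)%N ->
    scaled_integral p r.+1 0 (n%:R^-1 *: (c *: X_over p)).
  case: n => [_|n le_n]; first by rewrite invr0 scale0r scaled_integral0.
  rewrite /X_over !scalerA; apply: scaled_integralZX.
  have -> : p%:R ^+ r.+1 * (n.+1%:R^-1 * c / p%:R) / p%:R ^+ 0 =
      c * (p%:R ^+ r / n.+1%:R) :> rat.
    by rewrite expr0 exprS; field; rewrite nat1r pnatr_eq0 p_neq0.
  by rewrite rpredM ?p_integral_expn_div.
rewrite rising_prod //; apply: scaled_integralM; first exact: integral_factor.
elim/big_ind: _ => [|q1 q2|n _]; first exact: scaled_integral1.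
  exact: scaled_integralM.
apply: scaled_integralD (scaled_integral1 _ _) (integral_factor _ _).
by rewrite (leq_trans (ltnW (ltn_ord n))).
Qed.

Lemma truncated_inv_error p E a j : (0 < a)%N ->
  residue_inv p a j - truncated_inv p E a j =
    (- j%:R) ^+ E * p%:R ^+ E / a%:R ^+ E * residue_inv p a j.
Proof.
move=> a_gt0; have a_neq0 : a%:R != 0 :> rat by rewrite pnatr_eq0 -lt0n.
have aj_neq0 : (a + p * j)%:R != 0 :> rat.
  by rewrite pnatr_eq0 -lt0n addn_gt0 a_gt0.
rewrite /residue_inv /truncated_inv; elim: E => [|E IH].
  by rewrite big_ord0 subr0 !expr0 divr1 !mul1r.
rewrite big_ord_recr /= opprD addrA IH !exprS.
have aE_neq0 : a%:R ^+ E != 0 :> rat by rewrite expf_neq0.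
rewrite natrD natrM in aj_neq0 *.
by field; rewrite aj_neq0 aE_neq0.
Qed.

Lemma residue_product_scaled_congr p r E N : prime p ->
  scaled_congr p r E (residue_product p (residue_inv p) N)
                     (residue_product p (truncated_inv p E) N).
Proof.
move=> pr; apply: (big_ind2 (scaled_congr p r E)) => [|* |j _];
  [exact: scaled_congr1 | exact: scaled_congrM |].
apply: (big_ind2 (scaled_congr p r E)) => [|* |a _];
  [exact: scaled_congr1 | exact: scaled_congrM |].
have co_pa : coprime p a.+1.
  by rewrite prime_coprime // gtnNdvd // -ltn_predRL ltn_ord.
have inv_a_int : a.+1%:R^-1 \in p_integral p by apply: p_integral_inv.
have inv_aj_int : residue_inv p a.+1 j \in p_integral p.
  by apply: p_integral_inv; rewrite /coprime addnC mulnC gcdnMDl.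
have nat_int (m : nat) : m%:R \in p_integral p by apply: rpred_nat.
have pX_neq0 : p%:R ^+ E != 0 :> rat.
  by rewrite expf_neq0 // pnatr_eq0 -lt0n prime_gt0.
apply: scaled_congr_linear => //.
  apply: rpred_sum => b _; rewrite -exprVn.
  by rewrite !rpredM ?rpredX ?rpredN.
rewrite truncated_inv_error // -[(a.+1%:R ^+ E)^-1]exprVn.
rewrite [(- j%:R) ^+ E * _]mulrC -!mulrA mulrC !mulrA divfK //.
by rewrite !rpredM ?rpredX ?rpredN.
Qed.

Lemma scaled_integral_rising_conv p r E (W : nat -> {poly rat}) : prime p ->
  (forall N, scaled_integral p r.+1 E (W N)) ->
  scaled_integral p r.+1 E (rising_conv (X_over p) (p ^ r) W).
Proof.
move=> pr W_int; rewrite /rising_conv.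
elim/big_ind: _ => [|q1 q2|N _]; first exact: scaled_integral0.
  exact: scaled_integralD.
apply: scaled_integralM (W_int N); apply: scaled_integralM.
  rewrite -[X_over p]scale1r.
  by apply: scaled_integral_rising; rewrite ?rpred1 // -ltnS.
rewrite -scaleN1r.
by apply: scaled_integral_rising; rewrite ?rpredN ?rpred1 ?leq_subr.
Qed.

(* The coefficient of t ^ k in the product of the rising factorials has p-adic
   valuation at least - k r. *)
Definition precision (r k n : nat) : nat := n + k * r.

Lemma Csum_truncated r k n p : prime p ->
  rat_congr (p ^ n) (Csum r.+1 k p)
    ((rising_conv (X_over p) (p ^ r)
       (residue_product p (truncated_inv p (precision r.+1 k n))))`_k *+ k`!).
Proof.
move=> pr; have p_gt0 := prime_gt0 pr; set E := precision r.+1 k n.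
apply: rat_congr_p_integral => //; rewrite Csum_rising_conv //.
rewrite -mulrnBl -coefB -rising_convB; set q := rising_conv _ _ _.
have q_int : scaled_integral p r.+1 E q.
  apply: scaled_integral_rising_conv => // N.
  by have [] := residue_product_scaled_congr r.+1 E N pr.
have pX_neq0 : p%:R ^+ (k * r.+1) != 0 :> rat.
  by rewrite expf_neq0 // pnatr_eq0 -lt0n.
have := scaled_integral_coef k q_int.
rewrite -exprM mulnC /E /precision exprD invfM mulrACA mulrC mulrA.
by rewrite divfK // mulrnAl => /rpredMn; apply.
Qed.

Lemma Csum_newton r k n p : prime p -> (0 < n)%N ->
  let E := precision r.+1 k n in
  rat_congr (p ^ n) (Csum r.+1 k p)
    ((\sum_(c < k * E) 'C((p ^ r).-1, c)%:R * rising c.+1 (X_over p) *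
       iter c.+1 fdiff (residue_product p (truncated_inv p E)) 0)`_k *+ k`!).
Proof.
move=> pr n_gt0 E; rewrite -coef_rising_conv_newton.
- exact: Csum_truncated.
- by rewrite expn_gt0 prime_gt0.
case: n n_gt0 @E => // n _ /= m le_mk.
apply: fdegree_leW (graded_residue_product p (fdegree_le_truncated_inv p _) m).
by rewrite leq_mul2r le_mk orbT.
Qed.

(** * Multiple harmonic sums *)

Section FinfunCons.
Variables (T : Type) (l : nat).

Definition fcons (y : T * {ffun 'I_l -> T}) : {ffun 'I_l.+1 -> T} :=
  [ffun i => oapp y.2 y.1 (unlift ord0 i)].

Lemma fcons_ord0 y : fcons y ord0 = y.1.
Proof. by rewrite ffunE unlift_none. Qed.

Lemma fcons_lift y j : fcons y (lift ord0 j) = y.2 j.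
Proof. by rewrite ffunE liftK. Qed.

Lemma fcons_bij : bijective fcons.
Proof.
exists (fun n : {ffun 'I_l.+1 -> T} => (n ord0, [ffun j => n (lift ord0 j)])).
  case=> a f; rewrite fcons_ord0; congr pair.
  by apply/ffunP => j; rewrite ffunE fcons_lift.
move=> n; apply/ffunP => i.
by case: (unliftP ord0 i) => [j|] ->; rewrite ?fcons_lift ?fcons_ord0 ?ffunE.
Qed.
End FinfunCons.

Lemma forall_ordS l (P : pred 'I_l.+1) :
  [forall i, P i] = P ord0 && [forall j : 'I_l, P (lift ord0 j)].
Proof.
apply/forallP/andP => [allP|[P0 /forallP PS] i].
  by split=> //; apply/forallP => j.
by case: (unliftP ord0 i) => [j|] ->.
Qed.

Definition decreasing_below M N l (n : {ffun 'I_l -> 'I_M.+1}) : bool :=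
  [forall i, (0 < n i <= N)%N]
  && [forall i : 'I_l, forall j : 'I_l, (i < j)%N ==> (n j < n i)%N].

Lemma decreasing_below_fcons M N l (a : 'I_M.+1) (f : {ffun 'I_l -> 'I_M.+1}) :
  decreasing_below N (fcons (a, f)) =
  (0 < a <= N)%N && decreasing_below a.-1 f.
Proof.
have head_decr : [forall j : 'I_l.+1,
      ((ord0 : 'I_l.+1) < j)%N ==> (fcons (a, f) j < fcons (a, f) ord0)%N]
    = [forall j : 'I_l, (f j < a)%N].
  rewrite forall_ordS fcons_ord0 /=.
  by apply: eq_forallb => j; rewrite fcons_lift.
have tail_decr : [forall i : 'I_l, forall j : 'I_l.+1, (lift ord0 i < j)%N ==>
      (fcons (a, f) j < fcons (a, f) (lift ord0 i))%N]
    = [forall i : 'I_l, forall j : 'I_l, (i < j)%N ==> (f j < f i)%N].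
  apply: eq_forallb => i; rewrite forall_ordS /=.
  by apply: eq_forallb => j; rewrite !fcons_lift.
rewrite /decreasing_below forall_ordS [X in _ && X]forall_ordS.
rewrite head_decr tail_decr fcons_ord0 -!andbA.
case: (boolP (0 < a)%N) => //= a_gt0.
case: (boolP (a <= N)%N) => //= le_aN; rewrite andbA; congr (_ && _).
under eq_forallb do rewrite fcons_lift.
apply/andP/forallP => [[/forallP f_bd /forallP f_lt] j|f_bd].
  by have /andP[-> _] := f_bd j; rewrite -ltnS prednK ?f_lt.
have lt_fa j : (f j < a)%N by have /andP[_] := f_bd j; rewrite -ltnS prednK.
split; apply/forallP => j //; have /andP[-> _] := f_bd j.
exact: leq_trans (ltnW (lt_fa j)) le_aN.
Qed.

Definition mhs_below (M N : nat) (s : seq nat) : rat :=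
  \sum_(n : {ffun 'I_(size s) -> 'I_M.+1} | decreasing_below N n)
     \prod_(i < size s) ((n i)%:R ^+ nth 0%N s i)^-1.

Lemma mhs_belowE N s : mhs N s = mhs_below N N s.
Proof.
apply: eq_bigl => n; congr (_ && _); apply: eq_forallb => i.
by rewrite -[(n i <= N)%N]ltnS ltn_ord andbT.
Qed.

Lemma mhs_below_cons M N x s : mhs_below M N (x :: s) =
  \sum_(a < M.+1 | (0 < a <= N)%N) (a%:R ^+ x)^-1 * mhs_below M a.-1 s.
Proof.
under [RHS]eq_bigr => a _ do rewrite mulr_sumr.
rewrite pair_big_dep [LHS](reindex (@fcons _ (size s))) /=.
  apply: eq_big => [[a f]|[a f] _]; first by rewrite decreasing_below_fcons.
  rewrite big_ord_recl fcons_ord0; congr (_ * _).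
  by apply: eq_bigr => i _; rewrite fcons_lift.
exact/onW_bij/fcons_bij.
Qed.

Fixpoint mhs_rec (s : seq nat) (N : nat) : rat :=
  if s is x :: s' then \sum_(a < N) (a.+1%:R ^+ x)^-1 * mhs_rec s' a else 1.

Lemma mhs_below_rec M N s : (N <= M)%N -> mhs_below M N s = mhs_rec s N.
Proof.
elim: s N => [|x s IH] N le_NM.
  rewrite /mhs_below (big_pred1 [ffun _ => ord0]) ?big_ord0 // => n.
  transitivity true; last by apply/esym/eqP/ffunP => -[].
  by apply/andP; split; apply/forallP => -[].
rewrite mhs_below_cons -(big_mkord (fun a => 0 < a <= N)%N
  (fun a => (a%:R ^+ x)^-1 * mhs_below M a.-1 s)).
rewrite big_mkcond big_nat_recl //= add0r -big_mkcond.
rewrite -(big_nat_widen 0 N M xpredT) // big_mkord.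
by apply: eq_bigr => a _; rewrite IH // (leq_trans _ le_NM) // ltnW.
Qed.

Lemma mhsE N s : mhs N s = mhs_rec s N.
Proof. by rewrite mhs_belowE mhs_below_rec. Qed.

Lemma mhs_nil N : mhs N [::] = 1.
Proof. by rewrite mhsE. Qed.

Lemma mhs0_cons x s : mhs 0 (x :: s) = 0.
Proof. by rewrite mhsE /= big_ord0. Qed.

Lemma mhsS_cons N x s : mhs N.+1 (x :: s) =
  mhs N (x :: s) + (N.+1%:R ^+ x)^-1 * mhs N s.
Proof. by rewrite !mhsE /= big_ord_recr. Qed.

(** * Lists of monomials *)

(* (d, (s, c, b)) stands for c * p ^ b * H_{p-1}(s) * t ^ d. *)
Definition mono : countType := (nat * mhs_term)%type.

Definition mk_mono (d : nat) (s : seq nat) (c : rat) (b : int) : mono :=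
  (d, (s, c, b)).
Definition mono_deg (m : mono) : nat := m.1.
Definition mono_term (m : mono) : mhs_term := m.2.
Definition mono_comp (m : mono) : seq nat := term_comp (mono_term m).
Definition mono_coef (m : mono) : rat := term_coef (mono_term m).
Definition mono_expo (m : mono) : int := term_expo (mono_term m).

Definition mono1 : mono := mk_mono 0 [::] 1 0.

Definition mono_mul (x y : mono) : mono :=
  mk_mono (mono_deg x + mono_deg y) (mono_comp x ++ mono_comp y)
    (mono_coef x * mono_coef y) (mono_expo x + mono_expo y).

Definition mul_monos (s t : seq mono) : seq mono :=
  [seq mono_mul x y | x <- s, y <- t].

Definition prod_monos (S : seq (seq mono)) : seq mono :=
  foldr mul_monos [:: mono1] S.

(* p ^ (r - 1) - (q + 1) *)
Definition binomial_factor (r q : nat) : seq mono :=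
  [:: mk_mono 0 [::] 1 r.-1; mk_mono 0 [::] (-1 * q.+1%:R) 0].

(* t / p + q *)
Definition rising_factor (q : nat) : seq mono :=
  [:: mk_mono 1 [::] 1 (-1); mk_mono 0 [::] q%:R 0].

(* 1 + t / (a + p * j) with E terms of its p-adic expansion kept. The powers of
   1 / a are left implicit: t ^ d * p ^ b always comes with a ^- (d + b), which
   [close_letter] turns into an entry of the composition. *)
Definition residue_factor (E j : nat) : seq mono :=
  mono1 :: [seq mk_mono 1 [::] ((-1 * j%:R) ^+ b) b | b <- iota 0 E].

Definition close_letter (m : mono) : mono :=
  mk_mono (mono_deg m) [:: (mono_deg m + `|mono_expo m|)%N]
    (mono_coef m) (mono_expo m).

Definition letters (E i : nat) : seq mono :=
  [seq close_letter m
     | m <- prod_monos [seq residue_factor E j | j <- iota 0 i]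
     & (0 < mono_deg m)%N].

Definition words (L : seq mono) (l : nat) : seq mono :=
  iter l (mul_monos L) [:: mono1].

Definition newton_coef (k c i : nat) : rat :=
  (-1) ^+ (c.+1 - i) * (k`! * 'C(c.+1, i))%:R / (c`! * c.+1`!)%:R.

Definition newton_summand (r k E c i l : nat) : seq mono :=
  mul_monos [:: mk_mono 0 [::] (newton_coef k c i) 0]
    (mul_monos (prod_monos [seq binomial_factor r q | q <- iota 0 c])
       (mul_monos (prod_monos [seq rising_factor q | q <- iota 0 c.+1])
          (words (letters E i) l))).

Definition newton_monos (r k E : nat) : seq mono :=
  flatten [seq flatten [seq flatten [seq newton_summand r k E c i l
    | l <- iota 0 k.+1] | i <- iota 0 c.+2] | c <- iota 0 (k * E)].

Definition C_terms (r k n : nat) : seq mhs_term :=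
  [seq mono_term m | m <- newton_monos r k (precision r k n) & mono_deg m == k].

(** * Computability of the list of terms *)

Lemma computable_mk_mono (X : countType) (d : X -> nat) (s : X -> seq nat)
    (c : X -> rat) (b : X -> int) :
  computable d -> computable s -> computable c -> computable b ->
  computable (fun x => mk_mono (d x) (s x) (c x) (b x)).
Proof.
by move=> cd cs cc cb; apply/computable_pair/computable_pair => //;
  apply: computable_pair.
Qed.

Lemma computable_mono_deg (X : countType) (m : X -> mono) :
  computable m -> computable (fun x => mono_deg (m x)).
Proof. exact: computable_fst. Qed.

Lemma computable_mono_term (X : countType) (m : X -> mono) :
  computable m -> computable (fun x => mono_term (m x)).
Proof. exact: computable_snd. Qed.

Lemma computable_mono_comp (X : countType) (m : X -> mono) :
  computable m -> computable (fun x => mono_comp (m x)).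
Proof. by move=> cm; apply/computable_fst/computable_fst/computable_snd. Qed.

Lemma computable_mono_coef (X : countType) (m : X -> mono) :
  computable m -> computable (fun x => mono_coef (m x)).
Proof. by move=> cm; apply/computable_snd/computable_fst/computable_snd. Qed.

Lemma computable_mono_expo (X : countType) (m : X -> mono) :
  computable m -> computable (fun x => mono_expo (m x)).
Proof. by move=> cm; apply/computable_snd/computable_snd. Qed.

#[local] Hint Resolve computable_mk_mono computable_mono_deg
  computable_mono_term computable_mono_comp computable_mono_coef
  computable_mono_expo : computable.

Lemma computable_mul_monos (X : countType) (s t : X -> seq mono) :
  computable s -> computable t -> computable (fun x => mul_monos (s x) (t x)).
Proof.
by move=> cs ct; rewrite /mul_monos /mono_mul; computability.
Qed.

#[local] Hint Resolve computable_mul_monos : computable.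

Lemma computable_prod_monos (X : countType) (S : X -> seq (seq mono)) :
  computable S -> computable (fun x => prod_monos (S x)).
Proof.
move=> cS; apply: (computable_foldr (g := fun=> mul_monos)).
- exact: cS.
- by computability.
- exact: computable_cst.
Qed.

#[local] Hint Resolve computable_prod_monos : computable.

Lemma computable_letters (X : countType) (E i : X -> nat) :
  computable E -> computable i -> computable (fun x => letters (E x) (i x)).
Proof.
by move=> cE ci; rewrite /letters /close_letter /residue_factor; computability.
Qed.

Lemma computable_words (X : countType) (L : X -> seq mono) (l : X -> nat) :
  computable L -> computable l -> computable (fun x => words (L x) (l x)).
Proof.
move=> cL cl; apply: (computable_iter (g := fun x => mul_monos (L x))).
- by computability.
- by computability.
- exact: computable_cst.
Qed.

#[local] Hint Resolve computable_letters computable_words : computable.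

Lemma computable_C_terms :
  computable (fun x : nat * nat * nat => C_terms x.1.1 x.1.2 x.2).
Proof.
rewrite /C_terms /newton_monos /newton_summand /newton_coef /precision.
by rewrite /binomial_factor /rising_factor; computability.
Qed.

(** * Evaluation of the list of terms *)

Lemma mono_compM x y : mono_comp (mono_mul x y) = mono_comp x ++ mono_comp y.
Proof. by []. Qed.

Lemma all_mul_monos (Q : pred mono) s t :
  (forall x y, Q x -> Q y -> Q (mono_mul x y)) ->
  all Q s -> all Q t -> all Q (mul_monos s t).
Proof.
move=> QM /allP Qs /allP Qt; apply/allP => _ /allpairsP[[x y] /= [xs yt ->]].
by apply: QM; [apply: Qs|apply: Qt].
Qed.

Lemma all_prod_monos (Q : pred mono) I (s : seq I) (F : I -> seq mono) :
  (forall x y, Q x -> Q y -> Q (mono_mul x y)) -> Q mono1 ->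
  (forall i, all Q (F i)) -> all Q (prod_monos [seq F i | i <- s]).
Proof.
move=> QM Q1 QF; elim: s => [|i s IH] /=; first by rewrite Q1.
exact: all_mul_monos.
Qed.

Lemma big_iota0 (R : Type) (idx : R) (op : Monoid.law idx) n (F : nat -> R) :
  \big[op/idx]_(i <- iota 0 n) F i = \big[op/idx]_(i < n) F i.
Proof. by rewrite -[n in iota _ n]subn0 big_mkord. Qed.

Section Evaluation.
Variable p : nat.
Hypothesis p_gt0 : (0 < p)%N.

Let p_neq0 : p%:R != 0 :> rat.
Proof. by rewrite pnatr_eq0 -lt0n. Qed.

Definition mono_val (m : mono) : {poly rat} :=
  (mono_coef m * p%:R ^ mono_expo m) *: 'X^(mono_deg m).

Definition monos_val (L : seq mono) : {poly rat} := \sum_(m <- L) mono_val m.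

Definition monos_mhs (N : nat) (L : seq mono) : {poly rat} :=
  \sum_(m <- L) mhs N (mono_comp m) *: mono_val m.

Lemma mono_valM x y : mono_val (mono_mul x y) = mono_val x * mono_val y.
Proof.
rewrite /mono_val exprD [p%:R ^ _]expfzDr // -scalerAl -scalerAr scalerA.
by rewrite mulrACA.
Qed.

Lemma mono_val1 : mono_val mono1 = 1.
Proof. by rewrite /mono_val expr0z mulr1 scale1r. Qed.

Lemma coef_mono_val m i : (mono_val m)`_i =
  if mono_deg m == i then mono_coef m * p%:R ^ mono_expo m else 0.
Proof. by rewrite coefZ coefXn eq_sym; case: eqP; rewrite ?mulr1 ?mulr0. Qed.

Lemma monos_valM s t : monos_val (mul_monos s t) = monos_val s * monos_val t.
Proof.
rewrite /monos_val /mul_monos big_allpairs_dep mulr_suml; apply: eq_bigr => x _.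
by rewrite mulr_sumr; apply: eq_bigr => y _; rewrite mono_valM.
Qed.

Lemma monos_val_prod I (s : seq I) (F : I -> seq mono) :
  monos_val (prod_monos [seq F i | i <- s]) = \prod_(i <- s) monos_val (F i).
Proof.
elim: s => [|i s IH]; last by rewrite big_cons -IH -monos_valM.
by rewrite big_nil /monos_val big_seq1 mono_val1.
Qed.

Lemma monos_mhsM N s t : all (fun m => mono_comp m == [::]) s ->
  monos_mhs N (mul_monos s t) = monos_val s * monos_mhs N t.
Proof.
move=> /allP s_nil; rewrite /monos_mhs /mul_monos big_allpairs_dep.
rewrite /monos_val mulr_suml.
apply: eq_big_seq => x xs; rewrite mulr_sumr; apply: eq_bigr => y _.
by rewrite mono_valM mono_compM (eqP (s_nil x xs)) -[RHS]scalerAr.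
Qed.

Lemma monos_mhs_flatten N n (F : nat -> seq mono) :
  monos_mhs N (flatten [seq F i | i <- iota 0 n]) =
  \sum_(i < n) monos_mhs N (F i).
Proof. by rewrite /monos_mhs big_flatten big_map big_iota0. Qed.

Lemma eval_terms_coef k L :
  eval_terms p [seq mono_term m | m <- L & mono_deg m == k] =
  (monos_mhs p.-1 L)`_k.
Proof.
rewrite /eval_terms big_map big_filter /monos_mhs coef_sum big_mkcond.
apply: eq_bigr => m _; rewrite coefZ coef_mono_val.
by case: eqP => _; rewrite ?mulr0 // mulrC.
Qed.

Definition is_letter (m : mono) : bool := size (mono_comp m) == 1%N.

Definition letter_sum (L : seq mono) (a : nat) : {poly rat} :=
  \sum_(m <- L) (a%:R ^+ head 0%N (mono_comp m))^-1 *: mono_val m.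

Lemma monos_mhs_words0 L N : monos_mhs N (words L 0) = 1.
Proof. by rewrite /monos_mhs big_seq1 mono_val1 mhs_nil scale1r. Qed.

Lemma monos_mhs0_wordsS L l : all is_letter L -> monos_mhs 0 (words L l.+1) = 0.
Proof.
move=> /allP L_letters; rewrite /monos_mhs /= /mul_monos big_allpairs_dep.
rewrite big_seq big1 // => x xL.
apply: big1 => y _; move: (L_letters x xL); rewrite /is_letter mono_compM.
by case: (mono_comp x) => [|s []] //= _; rewrite mhs0_cons scale0r.
Qed.

Lemma monos_mhsS_wordsS L l N : all is_letter L ->
  monos_mhs N.+1 (words L l.+1) =
  monos_mhs N (words L l.+1) + letter_sum L N.+1 * monos_mhs N (words L l).
Proof.
move=> /allP L_letters; rewrite /monos_mhs /= /mul_monos !big_allpairs_dep.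
rewrite /letter_sum mulr_suml -big_split; apply: eq_big_seq => x xL.
rewrite mulr_sumr -big_split; apply: eq_bigr => y _ /=.
move: (L_letters x xL); rewrite /is_letter mono_valM !mono_compM.
case: (mono_comp x) => [|s []] //= _; rewrite mhsS_cons scalerDl; congr (_ + _).
move: (mono_val x) (mono_val y) => u v.
by rewrite -[RHS]scalerAl -scalerAr scalerA.
Qed.

(* Only words of length at most k contribute to the coefficient of X ^ k, as
   every letter is divisible by X. *)
Lemma coef_prod_letter_sum L N K k : all is_letter L ->
  (forall a, (letter_sum L a)`_0 = 0) -> (k <= K)%N ->
  (\prod_(a < N) (1 + letter_sum L a.+1))`_k =
  (\sum_(l < K.+1) monos_mhs N (words L l))`_k.
Proof.
move=> L_letters L0; elim: N K k => [|N IH] K k le_kK.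
  rewrite big_ord0 big_ord_recl monos_mhs_words0 big1 ?addr0 // => l _.
  by rewrite monos_mhs0_wordsS.
rewrite big_ord_recr /= mulrDr mulr1 coefD (IH K k le_kK).
rewrite ![\sum_(l < K.+1) _]big_ord_recl !monos_mhs_words0 /=.
under [in RHS]eq_bigr => l _ do rewrite monos_mhsS_wordsS //.
rewrite big_split -mulr_sumr addrA [in RHS]coefD; congr (_ + _).
rewrite mulrC !coefM; apply: eq_bigr => -[[|j] lt_jk] _ /=.
  by rewrite L0 !mul0r.
congr (_ * _); case: K le_kK => [|K] le_kK; first by lia.
by rewrite (IH K) //; lia.
Qed.
End Evaluation.

(* The value of m, once [close_letter] has made its powers of 1 / a explicit,
   at the entry a of the multiple harmonic sum. *)
Definition letter_weight (p a : nat) (m : mono) : {poly rat} :=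
  (a%:R ^+ (mono_deg m + `|mono_expo m|))^-1 *: mono_val p m.

Definition nonneg_expo (m : mono) : bool := 0 <= mono_expo m.

Lemma nonneg_expoM x y :
  nonneg_expo x -> nonneg_expo y -> nonneg_expo (mono_mul x y).
Proof. exact: addr_ge0. Qed.

Lemma letter_weightM p a x y : (0 < p)%N -> nonneg_expo x -> nonneg_expo y ->
  letter_weight p a (mono_mul x y) = letter_weight p a x * letter_weight p a y.
Proof.
move=> p_gt0 x_ge0 y_ge0; rewrite /letter_weight mono_valM //.
move: (mono_val p x) (mono_val p y) => u v.
rewrite -[RHS]scalerAl -scalerAr scalerA -invfM -exprD.
congr ((_ ^+ _)^-1 *: _); move: x_ge0 y_ge0; rewrite /nonneg_expo.
rewrite -[mono_deg (mono_mul x y)]/(mono_deg x + mono_deg y)%N.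
rewrite -[mono_expo (mono_mul x y)]/(mono_expo x + mono_expo y).
by lia.
Qed.

Lemma letter_weight1 p a : letter_weight p a mono1 = 1.
Proof. by rewrite /letter_weight mono_val1 invr1 scale1r. Qed.

Lemma sum_letter_weight_prod p a I (s : seq I) (F : I -> seq mono) :
  (0 < p)%N -> (forall i, all nonneg_expo (F i)) ->
  \sum_(m <- prod_monos [seq F i | i <- s]) letter_weight p a m =
  \prod_(i <- s) \sum_(m <- F i) letter_weight p a m.
Proof.
move=> p_gt0 F_ge0; elim: s => [|i s IH].
  by rewrite big_nil big_seq1 letter_weight1.
rewrite big_cons -IH /= /mul_monos big_allpairs_dep mulr_suml.
apply: eq_big_seq => x xF; rewrite mulr_sumr; apply: eq_big_seq => y ys.
have /allP prod_ge0 := all_prod_monos s nonneg_expoM isT F_ge0.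
by apply: letter_weightM => //; [apply: (allP (F_ge0 i))|apply: prod_ge0].
Qed.

Lemma nonneg_expo_residue_factor E j : all nonneg_expo (residue_factor E j).
Proof. by apply/allP => m; rewrite inE => /predU1P[->|/mapP[b _ ->]]. Qed.

Lemma sum_letter_weight_residue_factor p E a j :
  \sum_(m <- residue_factor E j) letter_weight p a m =
  1 + truncated_inv p E a j *: 'X.
Proof.
rewrite /residue_factor big_cons letter_weight1 big_map big_iota0.
rewrite /truncated_inv scaler_suml; congr (_ + _); apply: eq_bigr => b _.
by rewrite /letter_weight /mono_val scalerA expr1 mulN1r add1n mulrC exprnP.
Qed.

Lemma sum_letter_weight_deg0 p a L :
  \sum_(m <- L | mono_deg m == 0%N) letter_weight p a m =
  ((\sum_(m <- L) letter_weight p a m)`_0)%:P.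
Proof.
have coef_weight m k : (letter_weight p a m)`_k =
    if mono_deg m == k then (letter_weight p a m)`_k else 0.
  by rewrite coefZ coef_mono_val; case: eqP; rewrite ?mulr0.
apply/polyP => k; rewrite coefC !coef_sum; case: k => [|k] /=.
  rewrite [RHS](bigID (fun m => mono_deg m == 0%N)) /=.
  rewrite [X in _ + X]big1 ?addr0 // => m /negPf m0.
  by rewrite coef_weight m0.
by apply: big1 => m /eqP m0; rewrite coef_weight m0.
Qed.

Lemma all_is_letter_letters E i : all is_letter (letters E i).
Proof. by apply/allP => m /mapP[m' _ ->]. Qed.

Lemma letter_sum_letters p E i a : letter_sum p (letters E i) a =
  \sum_(m <- prod_monos [seq residue_factor E j | j <- iota 0 i]
          | (0 < mono_deg m)%N) letter_weight p a m.
Proof. by rewrite /letter_sum /letters big_map big_filter. Qed.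

Lemma coef0_letter_sum_letters p E i a : (letter_sum p (letters E i) a)`_0 = 0.
Proof.
rewrite letter_sum_letters coef_sum; apply: big1 => m m_gt0.
by rewrite coefZ coef_mono_val gtn_eqF ?mulr0.
Qed.

Lemma add1_letter_sum_letters p E i a : (0 < p)%N ->
  1 + letter_sum p (letters E i) a =
    \prod_(j < i) (1 + truncated_inv p E a j *: 'X).
Proof.
move=> p_gt0; rewrite letter_sum_letters; set L := prod_monos _.
have sum_L : \sum_(m <- L) letter_weight p a m =
    \prod_(j < i) (1 + truncated_inv p E a j *: 'X).
  rewrite sum_letter_weight_prod //; last exact: nonneg_expo_residue_factor.
  rewrite big_iota0; apply: eq_bigr => j _.
  exact: sum_letter_weight_residue_factor.
rewrite -[RHS]sum_L [RHS](bigID (fun m => mono_deg m == 0%N)) /=.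
rewrite sum_letter_weight_deg0 sum_L.
rewrite (coef0_prod_linear i (truncated_inv p E a)).
by congr (_ + _); apply: eq_bigl => m; rewrite lt0n.
Qed.

Lemma coef_residue_product_words p E i k m : (0 < p)%N -> (m <= k)%N ->
  (residue_product p (truncated_inv p E) i)`_m =
  (\sum_(l < k.+1) monos_mhs p p.-1 (words (letters E i) l))`_m.
Proof.
move=> p_gt0 le_mk; rewrite -(coef_prod_letter_sum p_gt0 p.-1
  (all_is_letter_letters E i) (coef0_letter_sum_letters p E i) le_mk).
rewrite /residue_product exchange_big; congr (_`_m); congr polyseq.
by apply: eq_bigr => a _; rewrite add1_letter_sum_letters.
Qed.

Lemma monos_val_prod_binomial_factor p r c : (0 < p)%N ->
  monos_val p (prod_monos [seq binomial_factor r.+1 q | q <- iota 0 c]) =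
    (c`! * 'C((p ^ r).-1, c))%:R.
Proof.
move=> p_gt0; have P_gt0 : (0 < p ^ r)%N by rewrite expn_gt0 p_gt0.
have factorE q : monos_val p (binomial_factor r.+1 q) =
    (p ^ r)%:R - q.+1%:R.
  rewrite /monos_val big_cons big_seq1 /mono_val !expr0 !alg_polyC.
  rewrite expr0z mulr1 mul1r mulN1r polyCN polyC_natr.
  by rewrite -exprnP -natrX polyC_natr.
rewrite monos_val_prod // big_iota0 mulnC bin_ffact.
elim: c => [|c IH]; first by rewrite big_ord0 ffactn0.
rewrite big_ord_recr /= IH factorE ffactnSr natrM.
have [lt_Pc|le_cP] := ltnP (p ^ r).-1 c; first by rewrite ffact_small // !mul0r.
by rewrite natrB // -[in LHS](prednK P_gt0) -!natr1; ring.
Qed.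

Lemma monos_val_prod_rising_factor p c : (0 < p)%N ->
  monos_val p (prod_monos [seq rising_factor q | q <- iota 0 c]) =
    c`!%:R *: rising c (X_over p).
Proof.
move=> p_gt0; rewrite monos_val_prod // big_iota0 /rising scalerA mulfV.
  rewrite scale1r; apply: eq_bigr => q _; rewrite /monos_val big_cons big_seq1.
  rewrite /mono_val expr0 expr1 expr0z mulr1 mul1r alg_polyC polyC_natr.
  by rewrite /X_over -exprN1.
by rewrite pnatr_eq0 -lt0n fact_gt0.
Qed.

Lemma newton_coefE k c i : newton_coef k c i * (c`! * c.+1`!)%:R =
  (-1) ^+ (c.+1 - i) * (k`! * 'C(c.+1, i))%:R.
Proof. by rewrite divfK // pnatr_eq0 -lt0n muln_gt0 !fact_gt0. Qed.

Lemma monos_mhs_newton_summand p r k E c i l : (0 < p)%N ->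
  monos_mhs p p.-1 (newton_summand r.+1 k E c i l) =
  'C((p ^ r).-1, c)%:R * rising c.+1 (X_over p)
  * ((-1) ^+ (c.+1 - i) * 'C(c.+1, i)%:R
     * monos_mhs p p.-1 (words (letters E i) l)) *+ k`!.
Proof.
have comp_nilM x y : mono_comp x == [::] -> mono_comp y == [::] ->
    mono_comp (mono_mul x y) == [::].
  by move=> /eqP x_nil /eqP y_nil; rewrite mono_compM x_nil y_nil.
move=> p_gt0; rewrite /newton_summand !monos_mhsM ?all_prod_monos //.
rewrite monos_val_prod_binomial_factor // monos_val_prod_rising_factor //.
rewrite {1}/monos_val big_seq1 /mono_val expr0z mulr1 expr0 alg_polyC.
rewrite -[mono_coef _]/(newton_coef k c i).
have coefE : (newton_coef k c i)%:P * (c`! * c.+1`!)%:R =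
    (-1) ^+ (c.+1 - i) * (k`! * 'C(c.+1, i))%:R.
  rewrite -polyC_natr -polyCM newton_coefE polyCM rmorphXn rmorphN1.
  by rewrite polyC_natr.
move: (newton_coef k c i)%:P (rising _ _) (monos_mhs _ _ _) coefE.
move=> x R W coefE.
transitivity (x * (c`! * c.+1`!)%:R * ('C((p ^ r).-1, c)%:R * R * W)).
  by rewrite -mul_polyC polyC_natr !natrM; ring.
by rewrite coefE natrM -[RHS]mulr_natr; ring.
Qed.

Lemma eval_C_terms p r k n : (0 < p)%N ->
  let E := precision r.+1 k n in
  eval_terms p (C_terms r.+1 k n) =
  (\sum_(c < k * E) 'C((p ^ r).-1, c)%:R * rising c.+1 (X_over p) *
     iter c.+1 fdiff (residue_product p (truncated_inv p E)) 0)`_k *+ k`!.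
Proof.
move=> p_gt0 E; rewrite /C_terms eval_terms_coef /newton_monos -/E.
rewrite monos_mhs_flatten !coef_sum -sumrMnl; apply: eq_bigr => c _.
rewrite monos_mhs_flatten iter_fdiff_bin mulr_sumr !coef_sum -sumrMnl.
apply: eq_bigr => i _; rewrite monos_mhs_flatten.
under eq_bigr => l _ do rewrite monos_mhs_newton_summand //.
rewrite sumrMnl -!mulr_sumr coefMn !mulrA add0n; congr (_ *+ _).
rewrite !coefM; apply: eq_bigr => m _; congr (_ * _).
by rewrite (coef_residue_product_words _ _ p_gt0 (leq_subr m k)).
Qed.

Lemma C_terms_composition r k n t :
  t \in C_terms r k n -> is_composition (term_comp t).
Proof.
pose comp_pos m := is_composition (mono_comp m).
have comp_posM x y : comp_pos x -> comp_pos y -> comp_pos (mono_mul x y).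
  by rewrite /comp_pos mono_compM /is_composition all_cat => -> ->.
have letters_pos E i : all comp_pos (letters E i).
  apply/allP => x /mapP[m]; rewrite mem_filter => /andP[m_gt0 _] ->.
  by rewrite /comp_pos /is_composition /= andbT ltn_addr.
have words_pos E i l : all comp_pos (words (letters E i) l).
  by elim: l => // l IH; apply: all_mul_monos.
case/mapP=> m; rewrite mem_filter => /andP[_ m_in] ->.
case/flattenP: m_in => s /mapP[c _ ->{s}] /flattenP[s /mapP[i _ ->{s}]].
case/flattenP=> s /mapP[l _ ->{s}]; move: m; apply/allP.
by do 3?[apply: all_mul_monos => //]; apply: all_prod_monos.
Qed.

Local Close Scope ring_scope.

Theorem theorem2 :
  exists F : nat -> nat -> nat -> seq mhs_term,
    computable (fun x : nat * nat * nat => F x.1.1 x.1.2 x.2) /\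
    forall r k n : nat, 0 < r -> 0 < k -> 0 < n ->
      (forall t, t \in F r k n -> is_composition (term_comp t)) /\
      exists p0 : nat, forall p : nat, prime p -> p0 <= p ->
        rat_congr (p ^ n) (Csum r k p) (eval_terms p (F r k n)).
Proof.
exists C_terms; split; first exact: computable_C_terms.
move=> [//|r] k n _ _ n_gt0; split; first exact: C_terms_composition.
exists 0 => p pr _; rewrite eval_C_terms ?prime_gt0 //.
exact: Csum_newton.
Qed.
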